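(* Let $k,m$ be natural numbers and let $f\in\mathcal{T}_k$. Then $$\|f^{(m)}\|_\infty\ \ge\ C_{k,m}\cdot\|f\|_\infty,\qquad\text{where}\quad C_{k,m}=\frac{1}{\|I^{m-1}c_k\|_\infty}.$$ Here $I^{m-1}c_k$ is the $(m-1)$-fold zero-average primitive of the triangular function $c_k$ with period $2\pi/k$ (so $I^0c_k=c_k$).
   Context: Let $S^1=\mathbb{R}/2\pi\mathbb{Z}$ with the angular metric $d(x,y)=\min_{n\in\mathbb{Z}}|x-y-2\pi n|$ and the normalized measure $d\mu=\frac{1}{2\pi}dx$. Let $L^2=L^2(S^1,\mu)$ be the space of complex-valued $L^2$-functions on $S^1$. For $k\in\mathbb{N}=\{1,2,\dots\}$, $\mathcal{T}_k$ is the $L^2$-closure of the linear span of $\{e^{ijx}: j\in\mathbb{Z},\ |j|\ge k\}$. In particular $\mathcal{T}_1$ is the space of $L^2$-functions with zero average. Triangular function: $c(x)=\frac{\pi}{2}-d(x,0)$ for $x\in S^1$, and $c_k(x)=\frac{1}{k}c(kx)$. Operator $I:\mathcal{T}_1\to\mathcal{T}_1$: the bounded linear operator sending $\phi\in\mathcal{T}_1$ to the unique primitive function of $\phi$ with zero average. $I^{n}$ denotes its $n$-th iterate. Norms: $\|\cdot\|_\infty$ is the $L^\infty$-norm. For $m\in\mathbb{N}$, $W^{m,\infty}$ is the class of functions $f\in L^2(S^1,\mu)$ such that $f\in C^{m-1}(S^1)$ and $f$ is $m$ times differentiable at almost every point with bounded derivative. For $f\in W^{m,\infty}$, $\|f^{(m)}\|_\infty\in[0,\infty)$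 is the $L^\infty$-norm of the $m$-th derivative of $f$; for functions $f$ outside this class one sets $\|f^{(m)}\|_\infty:=\infty$.
   Formalization: The class W^{m,∞} is taken with f^{(m-1)} also Lipschitz (the usual Sobolev meaning); with only a bounded a.e. derivative the claim fails, e.g. for a periodic zero-mean Cantor function with k=m=1, whose derivative is 0 a.e. *)

(* Defs.v *)
From HB Require Import structures.
From mathcomp Require Import all_boot all_order all_algebra.
From mathcomp Require Import all_classical all_reals all_analysis.
From mathcomp Require Import complex.

Set Implicit Arguments.
Unset Strict Implicit.
Unset Printing Implicit Defensive.

Import Order.TTheory GRing.Theory Num.Theory.
Import Normc.
Import numFieldNormedType.Exports.

Local Open Scope classical_set_scope.
Local Open Scope ring_scope.
Local Open Scope complex_scope.

(* A function on the circle S^1 = R / 2 pi Z is a 2 pi-periodic function on R.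
   The real and imaginary parts of a complex-valued function of a real variable
   are measured, integrated and differentiated separately. *)

Local Notation Re := complex.Re.
Local Notation Im := complex.Im.

Section Circle.
Variable R : realType.
Implicit Types (f g phi : R -> R[i]) (x y t : R) (k m n : nat).

Definition circle_dist x y : R :=
  inf [set `|x - y - 2 * pi * n%:~R| | n in [set: int]].

Lemma invr_2pi_ge0 : 0 <= (2 * pi)^-1 :> R.
Proof. by rewrite invr_ge0 mulr_ge0// pi_ge0. Qed.

(* dx / (2 pi) carried by the fundamental domain [0, 2 pi[ *)
Definition circle_measure :=
  mscale (NngNum invr_2pi_ge0)
    (mrestr (@lebesgue_measure R) (measurable_itv `[0, 2 * pi[)).

HB.instance Definition _ := Measure.on circle_measure.

Local Notation mu := circle_measure.

Definition cLnorm (p : \bar R) f : \bar R :=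
  Lnorm mu p (fun x => (normc (f x))%:E).

Definition circle_fun f : Prop := forall x, f (x + 2 * pi) = f x.

Definition L2 f : Prop :=
  [/\ circle_fun f,
      measurable_fun [set: R] (fun x => Re (f x)),
      measurable_fun [set: R] (fun x => Im (f x)) &
      (cLnorm 2%:E f < +oo)%E].

Definition expi x : R[i] := cos x +i* sin x.

Definition high_trig k : set (R -> R[i]) :=
  [set p | exists (s : seq int) (a : int -> R[i]),
     all (fun j => k <= `|j|)%N s /\
     p = fun x => \sum_(j <- s) a j * expi (j%:~R * x)].

Definition calT k : set (R -> R[i]) :=
  [set f | L2 f /\ forall e : R, 0 < e ->
     exists2 p, high_trig k p & (cLnorm 2%:E (fun x => f x - p x)%R < e%:E)%E].

Definition triangle x : R := pi / 2 - circle_dist x 0.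

Definition triangle_k k x : R[i] := (k%:R^-1 * triangle (k%:R * x))%:C.

Definition cintegral (nu : {measure set (measurableTypeR R) -> \bar R}) (D : set R) f : R[i] :=
  (\int[nu]_(t in D) Re (f t)) +i* (\int[nu]_(t in D) Im (f t)).

(* The integral of phi from 0 to x; for x < 0 the first interval is empty,
   for x > 0 the second one is. *)
Definition primitive0 phi x : R[i] :=
  cintegral lebesgue_measure `[0, x] phi - cintegral lebesgue_measure `[x, 0] phi.

(* The operator I; it is only meaningful on calT 1. *)
Definition mean0_primitive phi x : R[i] :=
  primitive0 phi x - cintegral mu setT (primitive0 phi).

(* Junk value at points where f is not n times differentiable. *)
Definition cderiven n f x : R[i] :=
  derive1n n (fun t => Re (f t)) x +i* derive1n n (fun t => Im (f t)) x.

Definition cderivable f x : Prop :=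
  derivable (fun t => Re (f t)) x 1 /\ derivable (fun t => Im (f t)) x 1.

Definition ccontinuous f : Prop :=
  continuous (fun t => Re (f t)) /\ continuous (fun t => Im (f t)).

Definition Cclass n f : Prop :=
  (forall j x, (j < n)%N -> cderivable (cderiven j f) x) /\
  ccontinuous (cderiven n f).

(* The class W^{m,oo} for m >= 1. The Lipschitz condition on the derivative of
   order m - 1 is part of the meaning of "bounded m-th derivative": boundedness
   of the almost everywhere derivative alone would admit the devil's staircase,
   whose derivative is almost everywhere zero. *)
Definition Wclass m f : Prop :=
  [/\ L2 f, Cclass m.-1 f,
      exists L : R, forall x y,
        normc (cderiven m.-1 f x - cderiven m.-1 f y) <= L * `|x - y| &
      exists M : R, {ae mu, forall x,
        cderivable (cderiven m.-1 f) x /\ normc (cderiven m f x) <= M}].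

(* L^oo norm of the m-th derivative of the class of f modulo almost everywhere
   equality. Since continuous representatives are unique, the infimum ranges
   over at most one value; it is +oo when f has no representative in Wclass m. *)
Definition deriv_norm m f : \bar R :=
  ereal_inf [set cLnorm +oo (cderiven m g) |
             g in [set g | Wclass m g /\ {ae mu, forall x, f x = g x}]].

Definition Ckm k m : \bar R :=
  ((cLnorm +oo (iter m.-1 mean0_primitive (triangle_k k)))^-1)%E.

End Circle.

(* Main.v *)
Require Import Defs.
From mathcomp Require Import all_boot all_order all_algebra.
From mathcomp Require Import all_classical all_reals all_analysis.
From mathcomp Require Import measurable_realfun ess_sup_inf.
From mathcomp Require Import complex.
From mathcomp Require Import ring lra zify.

(* Suppose |f| peaks at x0 with |f(x0)| > M ||P||, where P = I^(m-1) c_k and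
   M = ||f^(m)||.  Rotate f so that f(x0) > 0, translate P so that |P| peaks at x0,
   and subtract the multiple of P that agrees with f at x0.  The difference has no
   frequencies below k, so by the Sturm-Hurwitz theorem it has at least 2k zeros per
   period.  For m > 1, x0 is a double one, and Rolle carries 2k + 1 zeros over to the
   derivative of order m - 1.  That derivative is the sum of an M-Lipschitz function
   and a triangular wave of slope greater than M in absolute value, so it is injective on
   each of the 2k arcs between corners of the wave, which leaves too few zeros.  For
   m = 1 the zero x0 is a corner, and uses up two arcs. *)

Set Implicit Arguments.
Unset Strict Implicit.
Unset Printing Implicit Defensive.

Import Order.TTheory GRing.Theory Num.Theory.
Import Normc.
Import numFieldNormedType.Exports.

Local Open Scope classical_set_scope.
Local Open Scope ring_scope.
Local Open Scope complex_scope.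

(** * Spectral gaps and multiplication by half-angle sines *)

Section SpectralGap.
Variable R : realType.
Implicit Types (g h : R -> R) (x a b c : R) (k l : nat).

(** The constant is the one that f = P itself dictates: the slopes of [triangle_k] are 1 and -1, so
    the m-th derivative of P has norm 1. Three points shape the proof. The m-th derivative of f
    exists only almost everywhere, whereas the zero count requires a pointwise Lipschitz bound with
    the sharp constant M; [Wclass] supplies some Lipschitz constant L, and a covering argument
    improves L to M. Membership in [calT k] is an L2 statement about f, whereas zeros are counted
    for a continuous representative g; the gap passes to g through integrals against cosines. The
    gap of P comes from a symmetry: c_k and all its iterated primitives change sign under
    translation by pi / k, and this alone excludes the frequencies below k. *)

Definition mean_zero h := exists2 H : R -> R,
  (forall x, is_derive x (1:R) H (h x)) & forall x, H (x + 2 * pi) = H x.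

(** The phase a covers cosines and sines at once, so that the gap survives translation. Vanishing
    integrals are encoded by periodic primitives, which keeps the algebra of gaps free of measure
    theory. *)
Definition spectral_gap k h := forall j a, (j < k)%N ->
  mean_zero (fun x => h x * cos (j%:R * x + a)).

Lemma mean_zeroD g h : mean_zero g -> mean_zero h ->
  mean_zero (fun x => g x + h x).
Proof.
move=> [G dG pG] [H dH pH]; exists (G \+ H) => x; last by rewrite /= pG pH.
exact: is_deriveD.
Qed.

Lemma mean_zeroZ c h : mean_zero h -> mean_zero (fun x => c * h x).
Proof.
move=> [H dH pH]; exists (c \*: H) => x; last by rewrite /= pH.
exact: is_deriveZ.
Qed.

Lemma is_derive_shift (H : R -> R) c x dH : is_derive (x + c) (1:R) H dH ->
  is_derive x (1:R) (fun t => H (t + c)) dH.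
Proof.
move=> dHx.
have dS : is_derive x (1:R) (fun t : R => t + c) 1.
  by apply: is_derive_eq; rewrite addr0.
have := @is_derive1_comp _ H (fun t : R => t + c) x dH 1 dHx dS.
by rewrite mulr1.
Qed.

Lemma is_derive_scale (H : R -> R) c x dH : is_derive (c * x) (1:R) H dH ->
  is_derive x (1:R) (fun t => H (c * t)) (c * dH).
Proof.
move=> dHx.
have dS : is_derive x (1:R) (fun t : R => c * t) c.
  have := @is_deriveZ R R R id c x 1 1 (is_derive_id _ _).
  by rewrite /GRing.scale/= mulr1.
have := @is_derive1_comp _ H (fun t : R => c * t) x dH c dHx dS.
by rewrite mulrC.
Qed.

Lemma mean_zero_shift c h : mean_zero h -> mean_zero (fun x => h (x + c)).
Proof.
move=> [H dH pH]; exists (fun x => H (x + c)) => x; first exact: is_derive_shift.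
by rewrite addrAC pH.
Qed.

Lemma spectral_gapD k g h : spectral_gap k g -> spectral_gap k h ->
  spectral_gap k (fun x => g x + h x).
Proof.
move=> sg sh j a jk.
rewrite [X in mean_zero X](_ : _ = fun x => g x * cos (j%:R * x + a) + h x * cos (j%:R * x + a)).
  by apply: mean_zeroD; [exact: sg|exact: sh].
by apply/funext => x; rewrite mulrDl.
Qed.

Lemma spectral_gapZ k c h : spectral_gap k h -> spectral_gap k (fun x => c * h x).
Proof.
move=> sh j a jk.
rewrite [X in mean_zero X](_ : _ = fun x => c * (h x * cos (j%:R * x + a))).
  by apply: mean_zeroZ; exact: sh.
by apply/funext => x; rewrite mulrA.
Qed.

Lemma spectral_gap_shift k c h :
  spectral_gap k h -> spectral_gap k (fun x => h (x + c)).
Proof.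
move=> sh j a jk.
rewrite [X in mean_zero X](_ : _ = fun x => (fun y => h y * cos (j%:R * y + (a - j%:R * c))) (x + c)).
  exact: (mean_zero_shift c (sh j (a - j%:R * c) jk)).
by apply/funext => x /=; congr (_ * cos _); ring.
Qed.

(* A product of two half-angle sines is a trigonometric polynomial of degree 1,
   so multiplying by it narrows the gap by 1. *)
Lemma spectral_gap_sin_pair k g a b : (0 < k)%N -> spectral_gap k.+1 g ->
  spectral_gap k (fun x => g x * (sin ((x - a) / 2) * sin ((x - b) / 2))).
Proof.
move=> k0 sg j p jk; set d := (b - a) / 2; set c := (a + b) / 2.
have sinsin x : sin ((x - a) / 2) * sin ((x - b) / 2) = (cos d - cos (x - c)) / 2.
  set u := (x - a) / 2; set v := (x - b) / 2.
  have -> : d = u - v by rewrite /d /u /v; field.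
  have -> : x - c = u + v by rewrite /c /u /v; field.
  by rewrite cosB cosD; field.
have coscos u v : cos u * cos v = 2^-1 * cos (u + v) + 2^-1 * cos (u - v) :> R.
  by rewrite cosB cosD; field.
have low : mean_zero (fun x => g x * cos (j%:R * x + p - (x - c))).
  (* The frequency here is j - 1. For j = 0 it is folded from -1 to 1 by the evenness of the cosine,
     and 1 is below [k.+1] because k > 0. *)
  case: j jk => [|j] jk.
    rewrite [X in mean_zero X](_ : _ = fun x => g x * cos (1%:R * x + (- p - c))).
      exact: sg.
    by apply/funext => x; rewrite -cosN; congr (_ * cos _); ring.
  rewrite [X in mean_zero X](_ : _ = fun x => g x * cos (j%:R * x + (p + c))).
    by apply: sg; lia.
  by apply/funext => x; congr (_ * cos _); rewrite -natr1; ring.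
rewrite [X in mean_zero X](_ : _ = fun x => (cos d / 2) * (g x * cos (j%:R * x + p)) +
   (- 4^-1 * (g x * cos (j.+1%:R * x + (p - c))) +
   - 4^-1 * (g x * cos (j%:R * x + p - (x - c))))).
  apply: mean_zeroD; first by apply: mean_zeroZ; apply: sg; lia.
  by apply: mean_zeroD; apply: mean_zeroZ => //; apply: sg; lia.
apply/funext => x; rewrite sinsin.
have -> : j.+1%:R * x + (p - c) = (j%:R * x + p) + (x - c) by rewrite -natr1; ring.
have := coscos (j%:R * x + p) (x - c).
set A := cos (j%:R * x + p); set B := cos (x - c); move=> AB.
transitivity (cos d / 2 * (g x * A) - g x / 2 * (A * B)); first by field.
by rewrite AB; field.
Qed.

(** The 2l factors are absorbed in pairs, each pair costing one frequency. A single half-angle sine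
    is not 2 pi-periodic, hence the even count. *)
Lemma spectral_gap_sin_prod k l g (s : seq R) : size s = l.*2 -> (0 < k)%N ->
  spectral_gap (l + k) g ->
  spectral_gap k (fun x => g x * \prod_(a <- s) sin ((x - a) / 2)).
Proof.
elim: l g s => [|l IH] g s; first by case: s => // _ _ sg j a jk; have := sg j a jk;
  under eq_fun do [rewrite -[g _]mulr1]; under [X in _ -> mean_zero X]eq_fun do [rewrite big_nil].
case: s => [//|a [//|b s]] [ss] k0 sg.
rewrite [X in spectral_gap _ X](_ : _ = fun x => (g x * (sin ((x - a) / 2) * sin ((x - b) / 2))) *
   \prod_(a <- s) sin ((x - a) / 2)).
  by apply: IH => //; apply: spectral_gap_sin_pair; [lia|exact: sg].
by apply/funext => x; rewrite !big_cons !mulrA.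
Qed.

End SpectralGap.

(* h keeps its sign on D between consecutive points of s; s' collects the points
   where it changes, and w a is any factor changing sign exactly at a. *)
Lemma sign_pattern (R : realDomainType) (D : R -> Prop) (w : R -> R -> R)
    (s : seq R) (h : R -> R) :
  (forall x, D x -> h x != 0) ->
  (forall a, a \in s -> ~ D a) ->
  (forall a x, a \in s -> D x -> (x < a -> w a x < 0) /\ (a < x -> 0 < w a x)) ->
  (forall x y, D x -> D y -> x < y -> (forall a, a \in s -> ~ (x < a < y)) ->
     0 < h x * h y) ->
  exists s', [/\ (size s' <= size s)%N, {subset s' <= s} &
    forall x y, D x -> D y ->
      0 < (h x * \prod_(a <- s') w a x) * (h y * \prod_(a <- s') w a y)].
Proof.
elim: s h => [|a s IH] h h0 sD sw hs.
  exists [::]; split => // x y Dx Dy; rewrite !big_nil !mulr1.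
  case: (ltgtP x y) => [xy|yx|->].
  - exact: hs.
  - by rewrite mulrC; exact: hs.
  - by rewrite -expr2 exprn_even_gt0//= h0.
have sD' b : b \in s -> ~ D b by move=> bs; apply: sD; rewrite inE bs orbT.
have sw' b x : b \in s -> D x -> (x < b -> w b x < 0) /\ (b < x -> 0 < w b x).
  by move=> bs; apply: sw; rewrite inE bs orbT.
(* Either the remaining points of s already separate the signs, and a is dropped, or there are
   witnesses x0 < a < y0 of a sign change at a, and a is kept with [h x * w a x] in place of h. *)
have [Q|/existsNP[x0 /existsNP[y0 /not_implyP[Dx0 /not_implyP[Dy0
   /not_implyP[xy0 /not_implyP[sxy0 hxy0]]]]]]] :=
    pselect (forall x y, D x -> D y -> x < y ->
      (forall a, a \in s -> ~ (x < a < y)) -> 0 < h x * h y).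
  have [s' [ss' subs' Hs']] := IH h h0 sD' sw' Q.
  exists s'; split => //; first by rewrite /= ltnW.
  by move=> b /subs'; rewrite inE orbC => ->.
have hxy0' : h x0 * h y0 < 0.
  by rewrite lt_neqAle mulf_eq0 negb_or !h0//= leNgt; exact/negP.
have axy0 : x0 < a < y0.
  apply: contrapT => naxy; apply: hxy0; apply: hs => // b; rewrite inE => /predU1P[->//|].
  exact: sxy0.
have wa x : D x -> (x < a -> w a x < 0) /\ (a < x -> 0 < w a x).
  by move=> Dx; apply: sw; rewrite ?inE ?eqxx.
have aD x : D x -> x != a.
  by move=> Dx; apply/eqP => xa; apply: (sD a); rewrite ?inE ?eqxx// -xa.
have lft x u : D x -> D u -> x < a -> u < a ->
    (forall b, b \in s -> ~ (x < b < a)) -> (forall b, b \in s -> ~ (u < b < a)) ->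
    0 < h x * h u.
  move=> Dx Du xa ua sx su; case: (ltgtP x u) => [xu|ux|->].
  - apply: hs => // b; rewrite inE => /predU1P[->|bs /andP[xb bu]].
      by rewrite (ltNge a) (ltW ua) andbF.
    by apply: (sx b bs); rewrite xb (lt_trans bu).
  - rewrite mulrC; apply: hs => // b; rewrite inE => /predU1P[->|bs /andP[xb bu]].
      by rewrite (ltNge a) (ltW xa) andbF.
    by apply: (su b bs); rewrite xb (lt_trans bu).
  - by rewrite -expr2 exprn_even_gt0//= h0.
have rgt x u : D x -> D u -> a < x -> a < u ->
    (forall b, b \in s -> ~ (a < b < x)) -> (forall b, b \in s -> ~ (a < b < u)) ->
    0 < h x * h u.
  move=> Dx Du xa ua sx su; case: (ltgtP x u) => [xu|ux|->].
  - apply: hs => // b; rewrite inE => /predU1P[->|bs /andP[xb bu]].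
      by rewrite (ltNge x) (ltW xa).
    by apply: (su b bs); rewrite bu (lt_trans xa).
  - rewrite mulrC; apply: hs => // b; rewrite inE => /predU1P[->|bs /andP[xb bu]].
      by rewrite (ltNge u) (ltW ua).
    by apply: (sx b bs); rewrite bu (lt_trans ua).
  - by rewrite -expr2 exprn_even_gt0//= h0.
have wn0 x : D x -> w a x != 0.
  move=> Dx; have := aD x Dx; case: (ltgtP x a) => // ax _.
    by rewrite lt_eqF//; apply: (wa x Dx).1.
  by rewrite gt_eqF//; apply: (wa x Dx).2.
have [||s' [ss' subs' Hs']] := IH (fun x => h x * w a x) _ sD' sw'.
- by move=> x Dx; rewrite mulf_neq0 ?h0 ?wn0.
- move=> x y Dx Dy xy sxy; rewrite mulrACA.
  have := aD y Dy; case: (ltgtP y a) => // ya _.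
    have xa := lt_trans xy ya.
    apply: mulr_gt0; last by rewrite nmulr_rgt0 (wa _ _).1.
    apply: hs => // b; rewrite inE => /predU1P[->|]; last exact: sxy.
    by rewrite (ltNge a y) (ltW ya) andbF.
  have := aD x Dx; case: (ltgtP x a) => // xa _; last first.
    apply: mulr_gt0; last by rewrite mulr_gt0 ?(wa _ _).2.
    apply: hs => // b; rewrite inE => /predU1P[->|]; last exact: sxy.
    by rewrite (ltNge x a) (ltW xa).
  (* Now x < a < y. No point of s separates x from x0 or y from y0, so h changes sign from x to y as
     it does from x0 to y0, and [w a] undoes the change. *)
  move/andP: axy0 => [xa0 ya0].
  have P1 : 0 < h x * h x0.
    apply: lft => // b bs /andP[b1 b2].
      by apply: (sxy b bs); rewrite b1 (lt_trans b2).
    by apply: (sxy0 b bs); rewrite b1 (lt_trans b2).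
  have P2 : 0 < h y * h y0.
    apply: rgt => // b bs /andP[b1 b2].
      by apply: (sxy b bs); rewrite b2 andbT (lt_trans xa).
    by apply: (sxy0 b bs); rewrite b2 andbT (lt_trans xa0).
  have : 0 < (h x * h y) * (h x0 * h y0) by rewrite mulrACA mulr_gt0.
  rewrite nmulr_lgt0// => hxy.
  by rewrite nmulr_rgt0// nmulr_rlt0 ?(wa _ _).1 ?(wa _ _).2.
exists (a :: s'); split => //.
  by move=> b; rewrite !inE => /predU1P[->|/subs' ->]; rewrite ?eqxx ?orbT.
by move=> x y Dx Dy; rewrite !big_cons !mulrA; have := Hs' x y Dx Dy; rewrite !mulrA.
Qed.

(** A failed search for n points of Z lists all of Z, so the zero set of a function can be handled
    as a sequence without a prior finiteness result. *)
Lemma finite_or_many (T : eqType) (Z : T -> Prop) n :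
  (exists s : seq T, [/\ size s = n, uniq s & forall x, x \in s -> Z x]) \/
  (exists s : seq T, (size s < n)%N /\ forall x, Z x <-> x \in s).
Proof.
elim: n => [|n [[s [sn us sZ]]|[s [sn sZ]]]]; first by left; exists [::].
  have [[x [Zx xs]]|nex] := pselect (exists x, Z x /\ x \notin s).
    left; exists (x :: s); split; rewrite /= ?sn ?xs//.
    by move=> y; rewrite inE => /predU1P[->//|/sZ].
  right; exists s; rewrite sn; split => // x; split; last exact: sZ.
  by move=> Zx; apply: contrapT => /negP xs; apply: nex; exists x.
by right; exists s; split => //; exact: ltnW.
Qed.

(** * The Sturm-Hurwitz theorem *)

Section SturmHurwitz.
Variable R : realType.
Implicit Types (g h : R -> R) (x a b c : R) (k l : nat).

Lemma continuous_itv (f : R -> R) a b : continuous f -> {within `[a, b], continuous f}.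
Proof. exact: continuous_subspaceT. Qed.

Lemma is_derive_continuous (f df : R -> R) :
  (forall x, is_derive x (1:R) f (df x)) -> continuous f.
Proof.
by move=> dff x; have [d _] := dff x; apply/differentiable_continuous/derivable1_diffP.
Qed.

Lemma IVT_sign g a b : a < b -> continuous g -> g a * g b < 0 ->
  exists2 c, a < c < b & g c = 0.
Proof.
move=> ab cg gab.
have [|c cab gc] := @IVT R g a b 0 (ltW ab) (continuous_itv cg).
  rewrite ge_min le_max.
  have [ga|ga] := leP (g a) 0.
    have [gb|gb] := leP 0 (g b); first by rewrite orbT.
    by move: gab; rewrite ltNge mulr_le0 ?(ltW gb).
  have [gb|gb] := leP (g b) 0; first by rewrite orbT (ltW ga).
  by move: gab; rewrite ltNge mulr_ge0 ?(ltW ga) ?(ltW gb).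
exists c => //; move: cab; rewrite in_itv/= !le_eqVlt => /andP[/predU1P[ca|ca]].
  by move: gab; rewrite ca gc mul0r !ltxx.
move=> /predU1P[cb|->]; last by rewrite ca.
by move: gab; rewrite -cb gc mulr0 !ltxx.
Qed.

Lemma sin_half_sign a x : 0 <= a < 2 * pi -> 0 < x < 2 * pi ->
  (x < a -> sin ((x - a) / 2) < 0) /\ (a < x -> 0 < sin ((x - a) / 2)).
Proof.
move=> a2 x2; split => xa; last by apply: sin_gt0_pi; apply/andP; split; lra.
rewrite -[X in sin X]opprK sinN oppr_lt0; apply: sin_gt0_pi; apply/andP; split; lra.
Qed.

(* Otherwise a product T of half-angle sines vanishing where g changes sign has
   degree below k, so g T has mean zero and constant sign. *)
Lemma sturm_hurwitz0 k g : (0 < k)%N -> continuous g -> spectral_gap k g ->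
  exists s : seq R, [/\ size s = k.*2.-1, uniq s &
    forall x, x \in s -> 0 < x < 2 * pi /\ g x = 0].
Proof.
move=> k0 cg sg.
have [//|[s [sk sZ]]] := @finite_or_many _ (fun x => 0 < x < 2 * pi /\ g x = 0) k.*2.-1.
exfalso.
have pi0 := pi_gt0 R.
pose D x := 0 < x < 2 * pi /\ g x != 0.
(* If g vanished on the whole open period, the points pi / (i + 1) would give more zeros than s can
   hold. *)
have [x0 Dx0] : exists x0, D x0.
  apply: contrapT => nD.
  pose t := [seq pi / i.+1%:R : R | i <- iota 0 (size s).+1].
  have : uniq t.
    rewrite map_inj_in_uniq ?iota_uniq// => i j _ _ /= /(mulfI (lt0r_neq0 pi0)).
    by move/invr_inj/eqP; rewrite eqr_nat eqSS => /eqP.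
  move=> ut; have := uniq_leq_size (s2 := s) ut; rewrite size_map size_iota ltnn => H.
  suff : false by []; apply: H => x /mapP[i _ ->].
  apply/sZ; have i01 : 0 < (pi : R) / i.+1%:R < 2 * (pi : R).
    rewrite divr_gt0//= ltr_pdivrMr// (@lt_le_trans _ _ (2 * pi))//; first lra.
    by rewrite ler_peMr//; [lra|rewrite ler1n].
  split => //; apply: contrapT => /eqP gi; apply: nD.
  by exists (pi / i.+1%:R).
have [||||s' [ss' subs' Hs']] := @sign_pattern R D (fun a x => sin ((x - a) / 2)) s g.
- by move=> x [].
- by move=> a /sZ [_ ga] []; rewrite ga eqxx.
- move=> a x /sZ [a2 _] [x2 _]; apply: sin_half_sign => //.
  by move: a2 => /andP[/ltW -> ->].
- move=> x y [x2 gx] [y2 gy] xy sxy; rewrite ltNge; apply/negP => gxy.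
  have [] := @IVT_sign g x y xy cg.
    by rewrite lt_neqAle gxy mulf_neq0.
  move=> c cxy gc; apply: (sxy c) => //; apply/sZ; split => //.
  by move: cxy x2 y2 => /andP[c1 c2] /andP[c3 c4] /andP[c5 c6]; rewrite (lt_trans c3)//= (lt_trans c2).
(* An odd number of sign changes is made even by the extra zero 0, whose factor is positive on the
   open period. Since [size s] is at most 2k - 2, the degree l stays below k. *)
have [l [s2 [ss2 lk Hs2]]] : exists l (s2 : seq R), [/\ size s2 = l.*2, (l < k)%N &
    forall x y, D x -> D y ->
      0 < (g x * \prod_(a <- s2) sin ((x - a) / 2)) * (g y * \prod_(a <- s2) sin ((y - a) / 2))].
  have [odds|evens] := boolP (odd (size s')).
    exists (size s').+1./2, (0 :: s'); split.
    - by rewrite /= -[LHS]odd_double_half /= odds.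
    - have := odd_double_half (size s').+1; rewrite [odd _]/= odds add0n.
      by rewrite -ltn_double => ->; apply: leq_ltn_trans (_ : (size s).+1 < _)%N => //; move: sk; case: (k.*2).
    - move=> x y Dx Dy; rewrite !big_cons ![g _ * (_ * _)]mulrCA mulrACA.
      apply: mulr_gt0; last exact: Hs'.
      have P0 z : D z -> 0 < sin ((z - 0) / 2).
        move=> [z2 _]; apply: (@sin_half_sign 0 z _ z2).2; last by case/andP: z2.
        by rewrite lexx/=; lra.
      by rewrite mulr_gt0 ?P0.
  exists (size s')./2, s'; split => //.
  - by rewrite -[LHS]odd_double_half (negbTE evens).
  - have := odd_double_half (size s'); rewrite (negbTE evens) /=.
    by rewrite add0n -ltn_double => ->; exact: leq_ltn_trans ss' (leq_trans sk (leq_pred _)).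
have sgl : spectral_gap (k - l) (fun x => g x * \prod_(a <- s2) sin ((x - a) / 2)).
  by apply: (@spectral_gap_sin_prod _ _ l) => //; [lia|rewrite subnKC// ltnW].
pose T x := g x * \prod_(a <- s2) sin ((x - a) / 2).
have [H dH pH] : mean_zero T.
  have := sgl 0%N 0; rewrite subn_gt0 => /(_ lk).
  by under eq_fun do rewrite mul0r addr0 cos0 mulr1.
(* The scaling by [T x0] makes F nondecreasing on the period. As F takes equal values at both ends
   it is constant there, so its derivative at x0, the square of [T x0], would be 0. *)
pose F := (T x0 \*: H).
have dF x : is_derive x (1:R) F (T x0 * T x) by exact: is_deriveZ.
have cF : continuous F by exact: is_derive_continuous dF.
have T0 x : 0 < x < 2 * pi -> 0 <= T x0 * T x.
  move=> x2; have [gx|gx] := eqVneq (g x) 0; first by rewrite {2}/T gx mul0r mulr0.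
  by apply: ltW; exact: Hs2.
have Fle x y : 0 <= x -> x <= y -> y <= 2 * pi -> F x <= F y.
  move=> x1; rewrite le_eqVlt => /predU1P[->//|xy] y2.
  have [z zxy E] := @MVT R F (fun x => T x0 * T x) x y xy (fun x _ => dF x) (continuous_itv cF).
  rewrite -subr_ge0 E mulr_ge0 ?subr_ge0 ?(ltW xy)//; apply: T0.
  by move: zxy; rewrite in_itv/= => /andP[z1 z2]; rewrite (le_lt_trans x1)//= (lt_le_trans z2).
have F02 : F (2 * pi) = F 0 by rewrite /F /= -(pH 0) add0r.
have [/andP[x1 x2] gx0] := Dx0.
have : is_derive x0 (1:R) F 0.
  apply: (@derive1_at_max R F 0 (2 * pi)).
  - lra.
  - by move=> t _; case: (dF t).
  - by rewrite in_itv/= x1.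
  - move=> t; rewrite in_itv/= => /andP[t1 t2].
    apply: (@le_trans _ _ (F (2 * pi))); first by apply: Fle => //; exact: ltW.
    by rewrite F02; apply: Fle => //; exact: ltW.
move=> [_ E0]; have [_ E1] := dF x0.
by have := Hs2 x0 x0 Dx0 Dx0; rewrite -/(T x0) -E1 E0 ltxx.
Qed.

(** With x0 moved to the origin, the 2k - 1 zeros inside the open period together with x0 make 2k
    zeros per period. *)
Lemma sturm_hurwitz k g x0 : (0 < k)%N -> continuous g ->
  (forall x, g (x + 2 * pi) = g x) -> spectral_gap k g -> g x0 = 0 ->
  exists z : nat -> R, [/\ z 0%N = x0, z k.*2 = x0 + 2 * pi,
    forall i, (i < k.*2)%N -> z i < z i.+1 &
    forall i, (i <= k.*2)%N -> g (z i) = 0].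
Proof.
move=> k0 cg pg sg gx0.
have [s [ss us sZ]] : exists s : seq R, [/\ size s = k.*2.-1, uniq s &
    forall x, x \in s -> 0 < x < 2 * pi /\ g (x + x0) = 0].
  apply: (@sturm_hurwitz0 k (fun x => g (x + x0))) => //; last exact: spectral_gap_shift.
  move=> x; apply: (@continuous_comp _ _ _ (fun x => x + x0) g); last exact: cg.
  by apply: cvgD; [exact: cvg_id|exact: cvg_cst].
pose t := sort <=%R s.
have st : size t = k.*2.-1 by rewrite size_sort.
have tZ x : x \in t -> 0 < x < 2 * pi /\ g (x + x0) = 0.
  by rewrite mem_sort; exact: sZ.
have t2 : sorted <%R t by rewrite sort_lt_sorted.
(* The list [0 :: t] has 2k entries, so the default value of [nth] is the closing point z_(2k) = 2
   pi. *)
pose z i := nth (2 * pi) (0 :: t) i.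
have kE : k.*2 = (size t).+1 by rewrite st prednK// double_gt0.
exists (fun i => z i + x0); split.
- by rewrite /z/= add0r.
- by rewrite /z kE nth_default// addrC.
- move=> i ik; rewrite ltrD2r /z.
  have [it|] := ltnP i (size t); last first.
    move=> ti; have -> : i = size t by move: ik; rewrite kE ltnS => ?; apply/eqP; rewrite eqn_leq ti andbT.
    rewrite [X in _ < X]nth_default//.
    case Et : (size t) => [|j] /=; first by rewrite mulr_gt0// pi_gt0.
    have /tZ[/andP[]//] : nth (2 * pi) t j \in t by rewrite mem_nth// Et.
  have : path <%R 0 t.
    rewrite path_min_sorted// ; apply/allP => y /tZ[/andP[] //].
  by move/(pathP (2 * pi)) => /(_ i it).
- move=> [|i] ik; first by rewrite /z/= add0r.
  have [it|it] := ltnP i (size t).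
    by have [] := tZ _ (mem_nth (2 * pi) it).
  by rewrite /z [nth _ _ _]nth_default//= addrC pg.
Qed.

End SturmHurwitz.

(** * Counting zeros on the circle by Rolle and by arcs *)

Section ZeroCount.
Variable R : realType.
Implicit Types (f df : R -> R) (x y tau : R) (k n N : nat) (z : nat -> R).

(** N zeros in cyclic order, unrolled to the line: [z N] is [z 0] one turn later. *)
Definition zero_chain f N z := [/\ z N = z 0%N + 2 * pi,
  forall i, (i < N)%N -> z i < z i.+1 & forall i, (i <= N)%N -> f (z i) = 0].

Lemma derive_periodic f df p : (forall x, is_derive x (1:R) f (df x)) ->
  (forall x, f (x + p) = f x) -> forall x, df (x + p) = df x.
Proof.
move=> dff pf x; have := is_derive_shift (dff (x + p)).
under [X in is_derive _ _ X]eq_fun do rewrite pf.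
by move=> [_ <-]; have [_ <-] := dff x.
Qed.

Lemma rolle_points f df N z : (forall x, is_derive x (1:R) f (df x)) ->
  zero_chain f N z ->
  exists c : nat -> R, forall i, (i < N)%N -> z i < c i < z i.+1 /\ df (c i) = 0.
Proof.
move=> dff [zN zi z0].
suff /choice[c cP] : forall i, exists c, (i < N)%N -> z i < c < z i.+1 /\ df c = 0 by exists c.
move=> i; have [iN|_] := ltnP i N; last by exists 0.
have [||c] := @Rolle R f (z i) (z i.+1) (zi i iN) _ (continuous_itv (is_derive_continuous dff)).
  by move=> x _; case: (dff x).
  by rewrite !z0// ltnW.
by rewrite in_itv/= => cz [_ E]; exists c => _; split => //; have [_ <-] := dff c.
Qed.

(** On a circle N zeros leave N gaps, so Rolle loses none; the chain closes with the translate of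
    its first zero. *)
Lemma zero_chain_derive f df N z : (0 < N)%N ->
  (forall x, is_derive x (1:R) f (df x)) -> (forall x, df (x + 2 * pi) = df x) ->
  zero_chain f N z -> exists w, zero_chain df N w.
Proof.
move=> N0 dff pdf zf; have [c cP] := rolle_points dff zf; have [zN zi z0] := zf.
exists (fun i => if (i < N)%N then c i else c 0%N + 2 * pi); split.
- by rewrite ltnn N0.
- move=> i iN; rewrite iN; have [iN1|iN1] := ltnP i.+1 N.
    have [/andP[_ c1] _] := cP i iN; have [/andP[c2 _] _] := cP i.+1 iN1.
    exact: lt_trans c2.
  have {}iN1 : i.+1 = N by apply/eqP; rewrite eqn_leq iN iN1.
  have [/andP[_ c1] _] := cP i iN; have [/andP[c2 _] _] := cP 0%N N0.
  by rewrite (lt_trans c1)// iN1 zN ltrD2r.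
- move=> i _; have [iN|iN] := ltnP i N; first exact: (cP i iN).2.
  by rewrite pdf; exact: (cP 0%N N0).2.
Qed.

(** The double zero [z 0] is itself a zero of the derivative and lies in none of the N open gaps,
    whence the extra one. *)
Lemma zero_chain_derive_double f df N z : (0 < N)%N ->
  (forall x, is_derive x (1:R) f (df x)) -> (forall x, df (x + 2 * pi) = df x) ->
  zero_chain f N z -> df (z 0%N) = 0 -> exists w, zero_chain df N.+1 w.
Proof.
move=> N0 dff pdf zf dz0; have [c cP] := rolle_points dff zf; have [zN zi z0] := zf.
exists (fun i => if i is j.+1 then if (j < N)%N then c j else z 0%N + 2 * pi else z 0%N); split.
- by rewrite ltnn.
- move=> [_|i iN]; first by rewrite N0; have [/andP[]] := cP 0%N N0.
  rewrite ltnS in iN; rewrite iN; have [iN1|iN1] := ltnP i.+1 N.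
    have [/andP[_ c1] _] := cP i iN; have [/andP[c2 _] _] := cP i.+1 iN1.
    exact: lt_trans c2.
  have {}iN1 : i.+1 = N by apply/eqP; rewrite eqn_leq iN iN1.
  by have [/andP[_ +] _] := cP i iN; rewrite iN1 zN.
- move=> [//|i] _; have [iN|iN] := ltnP i N; first exact: (cP i iN).2.
  by rewrite pdf.
Qed.

(** The arcs are closed, so that a corner belongs to both arcs meeting there; 2k arcs cover a
    period. *)
Definition inj_on_arcs k tau f := forall (i : int) x y,
  tau + i%:~R * (pi / k%:R) <= x <= tau + (i + 1)%:~R * (pi / k%:R) ->
  tau + i%:~R * (pi / k%:R) <= y <= tau + (i + 1)%:~R * (pi / k%:R) ->
  f x = f y -> x = y.

(** Two consecutive zeros cannot share a closed arc, so each step of the chain goes strictly past at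
    least one more corner. *)
Lemma zero_chain_arcs k f N z tau (i : int) : (0 < N)%N -> inj_on_arcs k tau f ->
  zero_chain f N z -> tau + i%:~R * (pi / k%:R) <= z 0%N ->
  tau + (i + N%:Z)%:~R * (pi / k%:R) < z 0%N + 2 * pi.
Proof.
move=> N0 injf [zN zi z0] iz; rewrite -zN.
suff H : forall j, (0 < j <= N)%N -> tau + (i + j%:Z)%:~R * (pi / k%:R) < z j by rewrite H// N0/=.
have step j : (j < N)%N -> tau + (i + j%:Z)%:~R * (pi / k%:R) <= z j ->
    tau + (i + j.+1%:Z)%:~R * (pi / k%:R) < z j.+1.
  move=> jN zj; rewrite ltNge; apply/negP => zj1.
  have jj : i + j.+1%:Z = i + j%:Z + 1 by rewrite -addn1 PoszD addrA.
  have zz := zi j jN; rewrite jj in zj1.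
  have E : z j = z j.+1.
    apply: (injf (i + j%:Z)).
    - by rewrite zj (le_trans (ltW zz)).
    - by rewrite zj1 (le_trans zj (ltW zz)).
    - by rewrite !z0// ltnW.
  by move: zz; rewrite E ltxx.
elim=> [//|j IH] /= jN; apply: step => //.
case: j IH jN => [|j] IH jN; first by rewrite addr0.
by apply/ltW/IH => /=; exact: ltnW.
Qed.

Lemma zero_count_contradiction k n (psi : nat -> R -> R) x0 tau : (0 < k)%N ->
  (forall j x, (j < n)%N -> is_derive x (1:R) (psi j) (psi j.+1 x)) ->
  continuous (psi n) -> (forall x, psi 0%N (x + 2 * pi) = psi 0%N x) ->
  spectral_gap k (psi 0%N) -> psi 0%N x0 = 0 ->
  ((0 < n)%N -> psi 1%N x0 = 0) -> (n = 0%N -> tau = x0) ->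
  inj_on_arcs k tau (psi n) -> False.
Proof.
move=> k0 dpsi cpsi ppsi spsi px0 p1x0 taux0 injpsi.
have pi0 := pi_gt0 R.
have kR : 0 < k%:R :> R by rewrite ltr0n.
have cpsi0 : continuous (psi 0%N).
  case: n dpsi cpsi {p1x0 taux0 injpsi} => [//|n] dpsi _.
  by apply: is_derive_continuous => x; exact: dpsi.
have pers j : (j <= n)%N -> forall x, psi j (x + 2 * pi) = psi j x.
  elim: j => [//|j IH] jn; apply: derive_periodic (IH (ltnW jn)) => x.
  exact: dpsi.
have [z [z0 zk zi zz]] := sturm_hurwitz k0 cpsi0 ppsi spsi px0.
have zc : zero_chain (psi 0%N) k.*2 z by split => //; rewrite z0.
have k2 : (0 < k.*2)%N by rewrite double_gt0.
have e2 : (k.*2)%:R * (pi / k%:R) = 2 * pi :> R.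
  by rewrite -muln2 natrM; field; rewrite gt_eqF.
(* For n = 0 the chain starts at the corner tau itself; 2k steps carry it strictly beyond tau + 2
   pi, which is where it ends. *)
have [n0|n0] := posnP n.
  rewrite n0 in injpsi; have := zero_chain_arcs (i := 0) k2 injpsi zc.
  rewrite z0 (taux0 n0) mul0r addr0 lexx => /(_ isT).
  by rewrite add0r -pmulrn e2 ltxx.
have chains j : (j < n)%N -> exists w, zero_chain (psi j.+1) k.*2.+1 w.
  elim: j => [|j IH] jn.
    apply: zero_chain_derive_double zc _ => //; last by rewrite z0 p1x0.
      by move=> x; exact: dpsi.
    exact: pers.
  have [w wc] := IH (ltnW jn); apply: zero_chain_derive wc => //.
    by move=> x; exact: dpsi.
  exact: pers.
have [w wc] := chains n.-1 (ltac:(by rewrite prednK)); rewrite prednK// in wc.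
pose h : R := pi / k%:R.
have h0 : 0 < h by rewrite divr_gt0.
(* The start [w 0] lies before corner i + 1, while 2k + 1 steps put [w 0 + 2 * pi] beyond corner i +
   1 + 2k, the translate of corner i + 1 by a full period. *)
pose i := Num.floor ((w 0%N - tau) / h).
have ile : tau + i%:~R * h <= w 0%N.
  by rewrite -lerBrDl -ler_pdivlMr// ge_floor.
have igt : w 0%N < tau + (i + 1)%:~R * h.
  by rewrite -ltrBlDl -ltr_pdivrMr// floorD1_gt.
have := zero_chain_arcs (ltn0Sn _) injpsi wc ile.
rewrite -addn1 addnC PoszD addrA [(i + 1 + _)%:~R]intrD mulrDl -pmulrn e2 addrA ltrD2r.
by move=> /(lt_trans igt); rewrite ltxx.
Qed.

End ZeroCount.

(** * Comparison of two derivative towers *)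

Section Comparison.
Variable R : realType.
Implicit Types (f df : R -> R) (x y : R) (k n : nat).

Lemma derive_at_max_norm f df x0 : (forall x, is_derive x (1:R) f (df x)) ->
  (forall x, `|f x| <= `|f x0|) -> df x0 = 0.
Proof.
have max0 (g dg : R -> R) : (forall x, is_derive x (1:R) g (dg x)) -> (forall x, g x <= g x0) -> dg x0 = 0.
  move=> dgg gx0; have [_ <-] := dgg x0.
  have [_ //] : is_derive x0 (1:R) g 0.
  apply: (@derive1_at_max R g (x0 - 1) (x0 + 1)) => //.
  - by lra.
  - by rewrite in_itv/=; lra.
move=> dff fx0; have [f0|f0] := leP 0 (f x0).
  apply: (max0 f) => // x; rewrite -[leRHS]ger0_norm//.
  exact: le_trans (ler_norm _) (fx0 x).
apply: oppr_inj; rewrite oppr0; apply: (max0 (\- f) (fun x => - df x)) => x /=.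
rewrite -[leRHS]ltr0_norm//; apply: le_trans (fx0 x).
by rewrite -normrN ler_norm.
Qed.

(** The absolute values allow slope 1 on some arcs and -1 on others without recording which. *)
Definition unit_slope_on_arcs k f := forall (i : int) x y,
  i%:~R * (pi / k%:R) <= x <= (i + 1)%:~R * (pi / k%:R) ->
  i%:~R * (pi / k%:R) <= y <= (i + 1)%:~R * (pi / k%:R) ->
  `|f x - f y| = `|x - y|.

Lemma comparison k n (G P : nat -> R -> R) M x0 y0 : (0 < k)%N ->
  (forall j x, (j < n)%N -> is_derive x (1:R) (G j) (G j.+1 x)) ->
  continuous (G n) -> (forall x, G 0%N (x + 2 * pi) = G 0%N x) ->
  spectral_gap k (G 0%N) -> (forall x y, `|G n x - G n y| <= M * `|x - y|) ->
  (forall j x, (j < n)%N -> is_derive x (1:R) (P j) (P j.+1 x)) ->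
  continuous (P n) -> (forall x, P 0%N (x + 2 * pi) = P 0%N x) ->
  spectral_gap k (P 0%N) -> unit_slope_on_arcs k (P n) ->
  (forall x, `|G 0%N x| <= `|G 0%N x0|) ->
  (forall y, `|P 0%N y| <= `|P 0%N y0|) -> (n = 0%N -> y0 = 0) ->
  0 < `|P 0%N y0| /\ `|G 0%N x0| <= M * `|P 0%N y0|.
Proof.
move=> k0 dG cG pG sG lipG dP cP pP sP slopeP Gx0 Py0 ny0.
have pi0 := pi_gt0 R.
have h0 : 0 < pi / k%:R :> R by rewrite divr_gt0// ltr0n.
(* A zero peak would make [P 0], and with it every derivative up to [P n], vanish identically,
   against the unit slope of [P n]. *)
have K0 : 0 < `|P 0%N y0|.
  rewrite normr_gt0; apply/eqP => P0.
  have Pj j : (j <= n)%N -> forall x, P j x = 0.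
    elim: j => [_ x|j IH jn x].
      by apply/eqP; rewrite -normr_le0 (le_trans (Py0 x))// P0 normr0.
    have [_ <-] := dP j x jn.
    have -> : P j = cst 0 by apply/funext => t; exact: IH (ltnW jn) t.
    exact: derive_cst.
  have := slopeP 0 0 (pi / k%:R); rewrite mul0r add0r mul1r !lexx (ltW h0) !Pj// subr0 sub0r normrN normr0.
  by rewrite gtr0_norm// => /(_ isT isT) E; move: h0; rewrite -E ltxx.
split => //; rewrite leNgt; apply/negP => MG.
(* The shift c brings the peak y0 of [P 0] to x0, and lam makes the values there agree. The corners
   of the shifted wave are x0 - y0 plus the multiples of pi / k. *)
pose lam := G 0%N x0 / P 0%N y0; pose c := y0 - x0.
have lamM : M < `|lam| by rewrite normrM normfV ltr_pdivlMr.
have xc : x0 + c = y0 by rewrite /c; ring.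
pose psi j x := G j x + - lam * P j (x + c).
apply: (@zero_count_contradiction R k n psi x0 (x0 - y0) k0).
- move=> j x jn; apply: is_deriveD; first exact: dG.
  apply: is_deriveZ; apply: is_derive_shift; exact: dP.
- move=> x; apply: (@cvgD _ R^o); first exact: cG.
  apply: (@cvgM R _ _ _ (cst (- lam))); first exact: cvg_cst.
  apply: (@continuous_comp _ _ _ (fun x => x + c) (P n)); last exact: cP.
  by apply: cvgD; [exact: cvg_id|exact: cvg_cst].
- by move=> x; rewrite /psi pG addrAC pP.
- apply: spectral_gapD => //; apply: spectral_gapZ; exact: spectral_gap_shift.
- rewrite /psi xc /lam mulNr mulfVK ?subrr//.
  by move: K0; rewrite normr_gt0.
- move=> n0; rewrite /psi xc.
  have -> : G 1%N x0 = 0.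
    by apply: (@derive_at_max_norm (G 0%N)) => // x; exact: dG.
  have -> : P 1%N y0 = 0.
    by apply: (@derive_at_max_norm (P 0%N)) => // x; exact: dP.
  by rewrite mulr0 addr0.
- by move=> /ny0 ->; rewrite subr0.
(* Equal values of psi at x and y on one arc force [G n] to vary by |lam| |x - y|, which exceeds M
   |x - y| unless x = y. *)
- move=> i x y xi yi E; apply/eqP; rewrite -subr_eq0 -normr_eq0.
  have sl : `|P n (x + c) - P n (y + c)| = `|x - y|.
    rewrite (slopeP i).
    - by rewrite opprD addrACA subrr addr0.
    - by move: xi; rewrite /c => /andP[? ?]; apply/andP; split; lra.
    - by move: yi; rewrite /c => /andP[? ?]; apply/andP; split; lra.
  have GE : G n x - G n y = lam * (P n (x + c) - P n (y + c)).
    by move: E; rewrite /psi; lra.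
  have := lipG x y; rewrite GE normrM sl => lamle.
  apply: contraT => xy0; move: lamle.
  by rewrite ler_pM2r ?lt_neqAle ?normr_ge0 1?eq_sym ?xy0// leNgt lamM.
Qed.

End Comparison.

(** * Primitives, and the gap of antiperiodic functions *)

Section Primitives.
Variable R : realType.
Implicit Types (h H : R -> R) (a b x y c : R) (k : nat).
Local Notation leb := (@lebesgue_measure R).

Definition int0 h x := \int[leb]_(t in `[0, x]) h t - \int[leb]_(t in `[x, 0]) h t.

Lemma continuous_integrable_itv h a b : continuous h ->
  leb.-integrable `[a, b] (EFin \o h).
Proof.
move=> ch; apply: continuous_compact_integrable; first exact: segment_compact.
exact: continuous_itv.
Qed.

Lemma Rintegral_itv_split h a b c : continuous h -> a <= b -> b <= c ->
  \int[leb]_(t in `[a, c]) h t =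
  \int[leb]_(t in `[a, b]) h t + \int[leb]_(t in `[b, c]) h t.
Proof.
move=> ch ab bc.
have := @Rintegral_itvB R h (BLeft a) (BRight c) b (continuous_integrable_itv a c ch).
rewrite !bnd_simp => /(_ ab bc) E.
rewrite -(@Rintegral_itv_obnd_cbnd R b (BRight c) h) -?E; first by ring.
apply: integrableS (continuous_integrable_itv b c ch) => //.
exact: subset_itv_oc_cc.
Qed.

Lemma Rintegral_itv_empty h a b : b <= a -> \int[leb]_(t in `[a, b]) h t = 0.
Proof.
rewrite le_eqVlt => /predU1P[->|ba]; first by rewrite set_itv1 Rintegral_set1.
by rewrite set_itv_ge ?Rintegral_set0// bnd_simp -ltNge.
Qed.

(** A base point a to the left of both 0 and x removes the case distinction on the sign of x, and
    the fundamental theorem applies to the integral from a. *)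
Lemma int0E h a x : continuous h -> a <= 0 -> a <= x ->
  int0 h x = \int[leb]_(t in `[a, x]) h t - \int[leb]_(t in `[a, 0]) h t.
Proof.
move=> ch a0 ax; rewrite /int0; have [x0|x0] := leP 0 x.
  by rewrite (Rintegral_itv_empty _ x0) subr0 (Rintegral_itv_split ch a0 x0); ring.
rewrite (Rintegral_itv_empty _ (ltW x0)) (Rintegral_itv_split ch ax (ltW x0)); ring.
Qed.

Lemma is_derive_int0 h : continuous h -> forall x, is_derive x (1:R) (int0 h) (h x).
Proof.
move=> ch x; pose a := Num.min x 0 - 1.
have [a0 ax] : a < 0 /\ a < x.
  by rewrite /a; split; rewrite ltrBlDr gt_min ?ltrDl ltr01 ?orbT.
pose g := (fun y => \int[leb]_(t in `[a, y]) h t) \+ cst (- \int[leb]_(t in `[a, 0]) h t).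
have [dF F'] : derivable (fun y => \int[leb]_(t in `[a, y]) h t : R^o) x 1 /\
    derive1 (fun y => \int[leb]_(t in `[a, y]) h t : R^o) x = h x.
  apply: (@continuous_FTC1_closed R h a x (x + 1)) => //; last exact: ch.
    by rewrite ltrDl.
  exact: continuous_integrable_itv.
have dF' : is_derive x (1:R) (fun y => \int[leb]_(t in `[a, y]) h t) (h x).
  by apply: DeriveDef => //; rewrite -derive1E.
apply: (@near_eq_is_derive _ _ _ g) => //.
  near=> y; rewrite /g /= (@int0E h a y ch (ltW a0))//.
  by apply/ltW; near: y; exact: lt_nbhsr.
have := is_deriveD dF' (is_derive_cst (- \int[leb]_(t in `[a, 0]) h t : R^o) x 1).
by rewrite addr0.
Unshelve. all: by end_near. Qed.

Lemma int00 h : int0 h 0 = 0.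
Proof. by rewrite /int0 subrr. Qed.

Lemma derive_eq_cst H1 H2 h : (forall x, is_derive x (1:R) H1 (h x)) ->
  (forall x, is_derive x (1:R) H2 (h x)) -> forall x y, H1 x - H2 x = H1 y - H2 y.
Proof.
move=> d1 d2 x y; apply: (@is_derive_0_is_cst R (H1 \- H2)) => z.
by apply: is_derive_eq; rewrite subrr.
Qed.

Lemma Rintegral_FTC2 h H a b : continuous h -> (forall x, is_derive x (1:R) H (h x)) ->
  a <= b -> \int[leb]_(t in `[a, b]) h t = H b - H a.
Proof.
move=> ch dH ab; pose c := Num.min a 0.
have c0 : c <= 0 by rewrite ge_min lexx orbT.
have ca : c <= a by rewrite ge_min lexx.
have := derive_eq_cst (is_derive_int0 ch) dH b a.
rewrite (@int0E h c)//; last exact: le_trans ab.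
rewrite (@int0E h c)// (Rintegral_itv_split ch ca ab); lra.
Qed.

(** The angle j pi / (2k) lies in [0, pi / 2[ exactly because j < k; this is what makes k the size
    of the gap of an antiperiodic function. *)
Lemma cos_half_neq0 k j : (0 < k)%N -> (j < k)%N -> cos (j%:R * (pi / k%:R) / 2) != 0 :> R.
Proof.
move=> k0 jk; have pi0 := pi_gt0 R.
have kR : 0 < k%:R :> R by rewrite ltr0n.
rewrite gt_eqF//; apply: cos_gt0_pihalf; apply/andP; split.
  by apply: (@lt_le_trans _ _ 0); [lra|rewrite !mulr_ge0 ?invr_ge0 ?pi_ge0 ?ler0n].
rewrite ltr_pM2r ?invr_gt0// mulrA ltr_pdivrMr// mulrC ltr_pM2l//.
by rewrite ltr_nat.
Qed.

Lemma antiperiodic_2pi k (h : R -> R) : (0 < k)%N ->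
  (forall x, h (x + pi / k%:R) = - h x) -> forall x, h (x + 2 * pi) = h x.
Proof.
move=> k0 ah x; have -> : 2 * pi = (k.*2)%:R * (pi / k%:R) :> R.
  by rewrite -muln2 natrM; field; rewrite pnatr_eq0 -lt0n.
have E i : h (x + i%:R * (pi / k%:R)) = (-1) ^+ i * h x.
  elim: i => [|i IH]; first by rewrite mul0r addr0 expr0 mul1r.
  by rewrite -natr1 mulrDl mul1r addrA ah IH exprS mulN1r mulNr.
by rewrite E -signr_odd odd_double expr0 mul1r.
Qed.

(* If U is a primitive of h (x) cos (j x + a - j pi / (2 k)), then U (x) - U (x + pi / k)
   is a primitive of a nonzero multiple of h (x) cos (j x + a), and it is 2 pi-periodic
   because U (x + 2 pi) - U (x) is constant. *)
Lemma spectral_gap_antiperiodic k h : (0 < k)%N -> continuous h ->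
  (forall x, h (x + pi / k%:R) = - h x) -> spectral_gap k h.
Proof.
move=> k0 ch ah j a jk; pose p : R := pi / k%:R; pose t := j%:R * p.
have kR : k%:R != 0 :> R by rewrite pnatr_eq0 -lt0n.
pose u x := h x * cos (j%:R * x + (a - t / 2)).
have cu : continuous u.
  move=> x; apply: cvgM; first exact: ch.
  apply: (@continuous_comp _ _ _ (fun x => j%:R * x + (a - t / 2)) (@cos R)); last exact: continuous_cos.
  by apply: cvgD; [apply: cvgM; [exact: cvg_cst|exact: cvg_id]|exact: cvg_cst].
pose U := int0 u; have dU := is_derive_int0 cu.
have ph := antiperiodic_2pi k0 ah.
have pu x : u (x + 2 * pi) = u x.
  rewrite /u ph; congr (_ * _).
  have -> : j%:R * (x + 2 * pi) + (a - t / 2) = j%:R * x + (a - t / 2) + (pi *+ 2) *+ j.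
    by rewrite -[_ *+ j]mulr_natl -mulr_natl; ring.
  by rewrite periodicn//; exact: cosD2pi.
have cU x y : U (x + 2 * pi) - U x = U (y + 2 * pi) - U y.
  apply: (@derive_eq_cst (fun x => U (x + 2 * pi)) U u) => // z.
  by rewrite -pu; apply: is_derive_shift; exact: dU.
pose c := (2 * cos (t / 2))^-1.
have c0 : cos (t / 2) != 0 by exact: cos_half_neq0.
exists (c \*: (U \- (fun x => U (x + p)))) => x; last first.
  by rewrite /= (addrAC x); congr (_ * _); have := cU x (x + p); lra.
have du : is_derive x (1:R) (fun x => U (x + p)) (u (x + p)).
  by apply: is_derive_shift; exact: dU.
apply: is_derive_eq.
rewrite /GRing.scale/= /u ah /c.
have -> : j%:R * x + (a - t / 2) = (j%:R * x + a) - t / 2 by ring.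
have -> : j%:R * (x + p) + (a - t / 2) = (j%:R * x + a) + t / 2 by rewrite /t; field.
by move: (j%:R * x + a) => A; rewrite cosB cosD; field.
Qed.

End Primitives.

(** * The triangular wave *)

Section TriangleWave.
Variable R : realType.
Implicit Types (x y : R) (k : nat).

Lemma circle_dist0_le x (n : int) : circle_dist x 0 <= `|x - 2 * pi * n%:~R|.
Proof.
rewrite /circle_dist subr0; apply: ge_inf; last by exists n.
by exists 0 => _ [m _ <-]; exact: normr_ge0.
Qed.

Lemma le_circle_dist0 x c : (forall n : int, c <= `|x - 2 * pi * n%:~R|) ->
  c <= circle_dist x 0.
Proof.
move=> cx; rewrite /circle_dist subr0; apply: lb_le_inf.
  by exists `|x - 2 * pi * 0%:~R|, 0.
by move=> _ [m _ <-].
Qed.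

Lemma circle_dist0_lipschitz x y : circle_dist x 0 - circle_dist y 0 <= `|x - y|.
Proof.
rewrite lerBlDr -lerBlDl; apply: le_circle_dist0 => n; rewrite lerBlDl.
apply: le_trans (circle_dist0_le x n) _.
by rewrite (le_trans _ (ler_normD _ _))// addrA subrK.
Qed.

Lemma circle_dist0_periodic x : circle_dist (x + 2 * pi) 0 = circle_dist x 0.
Proof.
apply/le_anti/andP; split; apply: le_circle_dist0 => n.
  rewrite (_ : x - _ = x + 2 * pi - 2 * pi * (n + 1)%:~R) ?circle_dist0_le//.
  by rewrite intrD; ring.
rewrite (_ : x + _ - _ = x - 2 * pi * (n - 1)%:~R) ?circle_dist0_le//.
by rewrite intrB; ring.
Qed.

Lemma circle_dist0_small x : `|x| <= pi -> circle_dist x 0 = `|x|.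
Proof.
move=> xpi; apply/le_anti/andP; split.
  by have := circle_dist0_le x 0; rewrite mulr0 subr0.
apply: le_circle_dist0 => n; have [->|n0] := eqVneq n 0; first by rewrite mulr0 subr0.
have n1 : 1 <= `|n%:~R : R| by rewrite -intr_norm ler1z -gtz0_ge1 normr_gt0.
have pi0 := pi_ge0 R.
have h1 : 2 * pi <= `|2 * pi * n%:~R| :> R.
  by rewrite normrM ger0_norm ?mulr_ge0// ler_peMr// mulr_ge0.
have h2 : `|2 * pi * n%:~R| <= `|x - 2 * pi * n%:~R| + `|x|.
  rewrite distrC; apply: le_trans (ler_normD _ _); by rewrite subrK.
lra.
Qed.

Lemma triangle_lipschitz x y : `|triangle x - triangle y| <= `|x - y|.
Proof.
rewrite ler_norml; apply/andP; split; rewrite /triangle.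
  by rewrite lerNl; apply: le_trans (circle_dist0_lipschitz x y); lra.
by rewrite distrC; apply: le_trans (circle_dist0_lipschitz y x); lra.
Qed.

Lemma periodic_int (f : R -> R) p x (n : int) : (forall x, f (x + p) = f x) ->
  f (x + n%:~R * p) = f x.
Proof.
move=> pf; have E (i : nat) y : f (y + i%:R * p) = f y.
  elim: i => [|i IH]; first by rewrite mul0r addr0.
  by rewrite -natr1 mulrDl mul1r addrA pf.
case: n => n; first exact: E.
by rewrite NegzE -(E n.+1 (x + _)) mulrNz mulNr subrK.
Qed.

Lemma circle_reduce x : exists (y : R) (n : int), x = y + n%:~R * (2 * pi) /\ - pi <= y <= pi.
Proof.
have pi0 := pi_gt0 R.
pose n := Num.floor ((x + pi) / (2 * pi)).
exists (x - n%:~R * (2 * pi)), n; rewrite subrK; split => //.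
have pp : 0 < 2 * pi :> R by rewrite mulr_gt0.
have := floor_itv ((x + pi) / (2 * pi)).
rewrite -/n intrD ler_pdivlMr// ltr_pdivrMr// mulrDl => /andP[h1 h2].
by apply/andP; split; lra.
Qed.

Lemma triangle_periodic x : triangle (x + 2 * pi) = triangle x.
Proof. by rewrite /triangle circle_dist0_periodic. Qed.

(** The distances from 0 to two opposite points of the circle add up to pi. *)
Lemma triangle_antiperiodic x : triangle (x + pi) = - triangle x.
Proof.
have pi0 := pi_gt0 R.
have [y [n [-> /andP[y1 y2]]]] := circle_reduce x.
rewrite addrAC !(periodic_int _ _ triangle_periodic).
rewrite /triangle (@circle_dist0_small y) ?ler_norml ?y1//.
have [y0|y0] := leP y 0.
  rewrite circle_dist0_small ?ler_norml; last by apply/andP; split; lra.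
  by rewrite (ler0_norm y0) ger0_norm; lra.
have -> : y + pi = y - pi + 2 * pi by ring.
rewrite circle_dist0_periodic circle_dist0_small ?ler_norml; last by apply/andP; split; lra.
by rewrite (gtr0_norm y0) ler0_norm; lra.
Qed.

Lemma triangle_le x : `|triangle x| <= pi / 2.
Proof.
have le y : triangle y <= pi / 2.
  by rewrite /triangle gerDl oppr_le0; apply: le_circle_dist0.
by rewrite ler_norml le andbT lerNl -triangle_antiperiodic le.
Qed.

Lemma triangle0 : triangle 0 = pi / 2 :> R.
Proof. by rewrite /triangle circle_dist0_small normr0 ?subr0 ?pi_ge0. Qed.

Lemma triangle_unit_slope x y (i : int) :
  i%:~R * pi <= x <= (i + 1)%:~R * pi -> i%:~R * pi <= y <= (i + 1)%:~R * pi ->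
  `|triangle x - triangle y| = `|x - y|.
Proof.
move=> xi yi.
(* For a fixed difference d the quantity has period pi in t, which reduces every arc to [0, pi],
   where the wave is pi / 2 - t. *)
pose f (d t : R) := `|triangle t - triangle (t + d)|.
have pf d t : f d (t + pi) = f d t.
  by rewrite /f (addrAC t) !triangle_antiperiodic -opprD normrN.
pose u := x - i%:~R * pi; pose v := y - i%:~R * pi.
have -> : `|triangle x - triangle y| = `|triangle u - triangle v|.
  have /= := periodic_int u i (pf (v - u)); rewrite /f.
  have -> : u + i%:~R * pi + (v - u) = y by rewrite /u /v; ring.
  have -> : u + i%:~R * pi = x by rewrite /u; ring.
  by rewrite (addrC u) subrK.
have -> : x - y = u - v by rewrite /u /v; ring.
move: xi yi; rewrite intrD mulrDl mul1r => /andP[x1 x2] /andP[y1 y2].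
have [u0 u1] : 0 <= u /\ u <= pi by rewrite /u; split; lra.
have [v0 v1] : 0 <= v /\ v <= pi by rewrite /v; split; lra.
rewrite /triangle !circle_dist0_small ?(ger0_norm u0) ?(ger0_norm v0)//.
by rewrite distrC; congr (`| _ |); ring.
Qed.

Definition rtriangle k x := k%:R^-1 * triangle (k%:R * x).

Lemma rtriangle_continuous k : continuous (@rtriangle k).
Proof.
move=> x; apply/cvgrPdist_le => e e0; near=> y; rewrite /rtriangle.
(* For k = 0 the inverse is 0 by convention and the function vanishes. *)
have [->|k0] := posnP k; first by rewrite invr0 !mul0r subrr normr0 ltW.
rewrite -mulrBr normrM gtr0_norm ?invr_gt0 ?ltr0n// ler_pdivrMl ?ltr0n//.
rewrite (le_trans (triangle_lipschitz _ _))// -mulrBr normrM ger0_norm// ler_pM2l ?ltr0n//.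
Unshelve. all: by end_near. Qed.

Lemma rtriangle_antiperiodic k x : (0 < k)%N -> rtriangle k (x + pi / k%:R) = - rtriangle k x.
Proof.
move=> k0; rewrite /rtriangle.
have -> : k%:R * (x + pi / k%:R) = k%:R * x + pi by field; rewrite pnatr_eq0 -lt0n.
by rewrite triangle_antiperiodic mulrN.
Qed.

Lemma rtriangle_unit_slope k : (0 < k)%N -> unit_slope_on_arcs k (@rtriangle k).
Proof.
move=> k0 i x y xi yi; have kR : 0 < k%:R :> R by rewrite ltr0n.
have E (t : R) : i%:~R * (pi / k%:R) <= t <= (i + 1)%:~R * (pi / k%:R) ->
    i%:~R * pi <= k%:R * t <= (i + 1)%:~R * pi.
  rewrite !mulrA => /andP[t1 t2]; move: t1 t2.
  by rewrite ler_pdivrMr// ler_pdivlMr// (mulrC t) => -> ->.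
rewrite /rtriangle -mulrBr normrM (triangle_unit_slope (E x xi) (E y yi)) -mulrBr normrM.
by rewrite gtr0_norm ?invr_gt0// gtr0_norm// mulrA mulVf ?mul1r// gt_eqF.
Qed.

Lemma rtriangle_le k x : `|rtriangle k x| <= `|rtriangle k 0|.
Proof.
rewrite /rtriangle !normrM mulr0 triangle0 (ger0_norm (x := pi / 2)); last first.
  by rewrite divr_ge0// pi_ge0.
by apply: ler_wpM2l => //; exact: triangle_le.
Qed.

End TriangleWave.

(** * Integrals over the circle and iterated zero-average primitives *)

Section CircleMeasure.
Variable R : realType.
Local Notation leb := (@lebesgue_measure R).
Local Notation mu := (@circle_measure R).

Lemma circle_measureE (A : set R) :
  mu A = (((2 * pi)^-1)%R%:E * leb (A `&` `[0%R, (2 * pi)%R[))%E.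
Proof. by []. Qed.

Lemma circle_null (A : set R) : mu A = 0%E -> leb (A `&` `[0, 2 * pi[) = 0%E.
Proof.
move/eqP; rewrite circle_measureE mule_eq0 eqe invr_eq0 mulf_eq0 pnatr_eq0/=.
by rewrite gt_eqF ?pi_gt0//= => /eqP.
Qed.

Lemma lebesgue_period : leb `[0, 2 * pi[ = (2 * pi)%:E.
Proof.
rewrite lebesgue_measure_itv/= lte_fin mulr_gt0 ?pi_gt0//.
by rewrite sube0.
Qed.

Lemma circle_measureT : mu setT = 1%E.
Proof.
rewrite circle_measureE setTI lebesgue_period -EFinM mulVf//.
by rewrite mulf_neq0// gt_eqF// pi_gt0.
Qed.

Lemma circle_measure_compl : mu (~` `[0, 2 * pi[) = 0%E.
Proof. by rewrite circle_measureE setICl measure0 mule0. Qed.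

Lemma ge0_circle_integral (f : R -> \bar R) : measurable_fun setT f ->
  (forall x, 0 <= f x)%E ->
  (\int[mu]_x f x = ((2 * pi)^-1)%R%:E * \int[leb]_(x in `[0%R, (2 * pi)%R]) f x)%E.
Proof.
move=> mf f0.
rewrite (@ge0_negligible_integral _ _ _ mu setT (~` `[0, 2 * pi[))//; last 2 first.
- exact: measurableC.
- exact: circle_measure_compl.
rewrite setTD setCK (@eq_measure_integral _ _ _ _ (mscale (NngNum (invr_2pi_ge0 R)) leb)); last first.
  by move=> A mA AD; rewrite [LHS]circle_measureE setIidl.
rewrite ge0_integral_mscale//; last exact: measurable_funS mf.
by rewrite integral_itv_bndo_bndc//; exact: measurable_funS mf.
Qed.

Lemma circle_Rintegral (u : R -> R) : continuous u ->
  \int[mu]_x u x = (2 * pi)^-1 * \int[leb]_(x in `[0, 2 * pi]) u x.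
Proof.
move=> cu; have mu' : measurable_fun setT (EFin \o u).
  by apply/measurable_EFinP; exact: continuous_measurable_fun.
have iu := continuous_integrable_itv 0 (2 * pi) cu.
rewrite /Rintegral integralE [in RHS]integralE !ge0_circle_integral//; last 2 first.
- exact: measurable_funeneg.
- exact: measurable_funepos.
have f1 := @integrable_pos_fin_num _ _ R leb _ (measurable_itv _) _ iu.
have f2 := @integrable_neg_fin_num _ _ R leb _ (measurable_itv _) _ iu.
rewrite -muleBr//; last by rewrite fin_num_adde_defl// fin_numN.
by rewrite fineM// fin_numB f1 f2.
Qed.

Lemma circle_Rintegral_mean_zero (u : R -> R) : continuous u -> mean_zero u ->
  \int[mu]_x u x = 0.
Proof.
move=> cu [U dU pU]; rewrite circle_Rintegral// (Rintegral_FTC2 cu dU) ?mulr_ge0 ?pi_ge0//.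
by rewrite -[X in U X]add0r pU subrr mulr0.
Qed.

Definition rprimitive (p : R -> R) x := int0 p x - \int[mu]_t int0 p t.

Lemma is_derive_rprimitive p x : continuous p -> is_derive x (1:R) (rprimitive p) (p x).
Proof.
move=> cp; have := is_deriveD (is_derive_int0 cp x)
  (is_derive_cst (- \int[mu]_t int0 p t : R^o) x 1).
by rewrite addr0.
Qed.

(** Translating a primitive U by pi / k gives 2c - U for some constant c. Then U - c is antiperiodic
    and has average zero, so c is the average of U, which is the constant subtracted in
    [rprimitive]. *)
Lemma rprimitive_antiperiodic k p : (0 < k)%N -> continuous p ->
  (forall x, p (x + pi / k%:R) = - p x) ->
  forall x, rprimitive p (x + pi / k%:R) = - rprimitive p x.
Proof.
move=> k0 cp ap.
have cU : continuous (int0 p) by exact: is_derive_continuous (is_derive_int0 cp).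
pose h : R := pi / k%:R; pose c := (int0 p h + int0 p 0) / 2.
have E x : int0 p (x + h) = - int0 p x + 2 * c.
  have dU1 y : is_derive y (1:R) (fun y => int0 p (y + h)) (- p y).
    by rewrite -ap; apply: is_derive_shift; exact: is_derive_int0.
  have dU2 y : is_derive y (1:R) (\- int0 p) (- p y).
    by apply: is_deriveN; exact: is_derive_int0.
  have := derive_eq_cst dU1 dU2 x 0; rewrite /= add0r /c.
  by move=> H; lra.
have cV : continuous (fun x => int0 p x - c).
  by move=> x; apply: (@cvgB _ R^o); [exact: cU|exact: cvg_cst].
have aV x : int0 p (x + h) - c = - (int0 p x - c) by rewrite E; lra.
have mV : mean_zero (fun x => int0 p x - c).
  have := @spectral_gap_antiperiodic R k _ k0 cV aV 0%N 0 k0.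
  by under eq_fun do rewrite mul0r addr0 cos0 mulr1.
have := circle_Rintegral_mean_zero cV mV.
rewrite circle_Rintegral// RintegralB//; last 2 first.
- exact: continuous_integrable_itv.
- by apply: (@continuous_integrable_itv R (cst c)); exact: cst_continuous.
have pi0 := pi_gt0 R.
rewrite Rintegral_cst// [X in c * fine X]lebesgue_measure_itv/= lte_fin mulr_gt0// sube0/=.
rewrite mulrBr -circle_Rintegral// => /eqP; rewrite subr_eq0 => /eqP mc.
have {}mc : \int[mu]_x int0 p x = c by rewrite mc mulrCA mulVf ?mulr1 ?gt_eqF ?mulr_gt0.
by move=> x; rewrite /rprimitive mc -aV.
Qed.

Lemma mean0_primitiveE (p : R -> R) :
  mean0_primitive (fun x => (p x)%:C) = fun x => (rprimitive p x)%:C.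
Proof.
have z (nu : {measure set (measurableTypeR R) -> \bar R}) D : \int[nu]_(t in D) (0 : R) = 0.
  by rewrite /Rintegral integral0.
have primE x : primitive0 (fun x => (p x)%:C) x = (int0 p x)%:C.
  by rewrite /primitive0 /cintegral /= !z; apply/eqP; rewrite eq_complex /= subrr !eqxx.
apply/funext => x; rewrite /mean0_primitive /rprimitive primE /cintegral.
under [X in X +i* _]eq_Rintegral do rewrite primE/=.
under [X in _ +i* X]eq_Rintegral do rewrite primE/=.
by rewrite z; apply/eqP; rewrite eq_complex /= subrr !eqxx.
Qed.

Lemma iter_mean0_primitive k n :
  iter n (@mean0_primitive R) (triangle_k k) =
  fun x => (iter n rprimitive (rtriangle k) x)%:C.
Proof. by elim: n => [//|n IH]; rewrite !iterS IH mean0_primitiveE. Qed.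

(** Antiperiodicity is the invariant of the iteration; periodicity and the spectral gap of each
    iterate both follow from it. *)
Lemma iter_rprimitive_cont_antiperiodic k n : (0 < k)%N ->
  continuous (iter n rprimitive (rtriangle k)) /\
  forall x, iter n rprimitive (rtriangle k) (x + pi / k%:R) = - iter n rprimitive (rtriangle k) x.
Proof.
move=> k0; elim: n => [|n [IHc IHa]]; split.
- exact: rtriangle_continuous.
- by move=> x; exact: rtriangle_antiperiodic.
- by apply: (@is_derive_continuous _ _ (iter n rprimitive (rtriangle k))) => x; exact: is_derive_rprimitive.
- by move=> x; rewrite !iterS; exact: rprimitive_antiperiodic.
Qed.

End CircleMeasure.

(** * Spectral gap of trigonometric polynomials *)

Section TrigPoly.
Variable R : realType.
Implicit Types (x a b c : R) (k j : nat).

Lemma mean_zero_cos (n : int) c : n != 0 -> mean_zero (fun x => cos (n%:~R * x + c)).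
Proof.
move=> n0; have nR : n%:~R != 0 :> R by rewrite intr_eq0.
exists (fun x => n%:~R^-1 * sin (n%:~R * x + c)) => x.
  have d1 : is_derive (n%:~R * x) (1:R) (fun y => sin (y + c)) (cos (n%:~R * x + c)).
    by apply: is_derive_shift; exact: is_derive_sin.
  have := is_deriveZ (n%:~R^-1) (is_derive_scale d1).
  by rewrite /GRing.scale/= mulrA mulVf// mul1r.
congr (_ * _); have -> : n%:~R * (x + 2 * pi) + c = n%:~R * x + c + n%:~R * (2 * pi) by ring.
apply: periodic_int => y; have := @sinD2pi R y.
by rewrite mulr2n mulr_natl mulr2n.
Qed.

(** The product of the two cosines has only the frequencies i + j and i - j, nonzero because j < k
    and |i| is at least k. *)
Lemma spectral_gap_cos k (i : int) b : (k <= `|i|)%N ->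
  spectral_gap k (fun x => cos (i%:~R * x + b)).
Proof.
move=> ki j a jk.
rewrite [X in mean_zero X](_ : _ = fun x =>
    2^-1 * cos ((i + j%:Z)%:~R * x + (b + a)) + 2^-1 * cos ((i - j%:Z)%:~R * x + (b - a))).
  by apply: mean_zeroD; apply: mean_zeroZ; apply: mean_zero_cos; apply/eqP; lia.
apply/funext => x.
have -> : (i + j%:Z)%:~R * x + (b + a) = (i%:~R * x + b) + (j%:R * x + a) by rewrite intrD -pmulrn; ring.
have -> : (i - j%:Z)%:~R * x + (b - a) = (i%:~R * x + b) - (j%:R * x + a) by rewrite intrB -pmulrn; ring.
by move: (i%:~R * x + b) (j%:R * x + a) => A B; rewrite cosB cosD; field.
Qed.

(** The term in -sin x is written as a shifted cosine, so that both terms fall under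
    [spectral_gap_cos]. *)
Lemma Re_mul_expi (z : R[i]) x :
  complex.Re (z * expi x) = complex.Re z * cos x + complex.Im z * cos (x + pi / 2).
Proof. by case: z => a b; rewrite cosDpihalf /=; ring. Qed.

Lemma ReD (z w : R[i]) : complex.Re (z + w) = complex.Re z + complex.Re w.
Proof. by case: z w => [a b] [c d]. Qed.

Lemma high_trig_Re k (p : R -> R[i]) (u : R[i]) : high_trig k p ->
  continuous (fun x => complex.Re (u * p x)) /\
  spectral_gap k (fun x => complex.Re (u * p x)).
Proof.
move=> [s [a [ks ->]]]; elim: s ks => [_|i s IH /= /andP[ki /IH[IHc IHs]]].
  under eq_fun do rewrite big_nil mulr0; split; first exact: cst_continuous.
  move=> j b jk; exists (cst 0) => // x; rewrite mul0r; exact: is_derive_cst.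
pose z := u * a i.
have -> : (fun x => complex.Re (u * \sum_(j <- i :: s) a j * expi (j%:~R * x))) =
    fun x => (complex.Re z * cos (i%:~R * x + 0) + complex.Im z * cos (i%:~R * x + pi / 2)) +
      complex.Re (u * \sum_(j <- s) a j * expi (j%:~R * x)).
  by apply/funext => x; rewrite big_cons mulrDr ReD mulrA Re_mul_expi addr0.
split; last first.
  by do 2 apply: spectral_gapD => //; apply: spectral_gapZ; exact: spectral_gap_cos.
have cc b : continuous (fun x => cos (i%:~R * x + b) : R).
  move=> x; apply: (@continuous_comp _ _ _ (fun x => i%:~R * x + b) (@cos R)); last exact: continuous_cos.
  by apply: cvgD; [apply: cvgM; [exact: cvg_cst|exact: cvg_id]|exact: cvg_cst].
move=> x; apply: (@cvgD _ R^o); last exact: IHc.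
by apply: (@cvgD _ R^o); apply: cvgM; [exact: cvg_cst|exact: cc|exact: cvg_cst|exact: cc].
Qed.

End TrigPoly.

(** * From L2 approximation to the gap of a continuous representative *)

Section HighFrequency.
Variable R : realType.
Local Notation leb := (@lebesgue_measure R).
Local Notation mu := (@circle_measure R).

Lemma circle_Rintegral_le_L2 (v : R -> R) (e : R) : 0 < e -> continuous v ->
  (\int[mu]_x (v x ^+ 2)%:E <= (e ^+ 2)%:E)%E -> `|\int[mu]_x v x| <= e.
Proof.
move=> e0 cv v2.
have cv2 : continuous (fun x => v x ^+ 2) by move=> x; apply: cvgM; exact: cv.
have ca : continuous (fun x => `|v x|) by move=> x; apply: cvg_norm; exact: cv.
have {}v2 : (2 * pi)^-1 * \int[leb]_(x in `[0, 2 * pi]) (v x ^+ 2) <= e ^+ 2.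
  rewrite -circle_Rintegral// -lee_fin /Rintegral fineK//.
  rewrite fin_real// (le_lt_trans v2) ?ltry// andbT.
  by apply: (@lt_le_trans _ _ 0%E); [exact: ltNyr|apply: integral_ge0 => x _; rewrite lee_fin sqr_ge0].
have pp : 0 < 2 * pi :> R by rewrite mulr_gt0// pi_gt0.
rewrite circle_Rintegral// normrM gtr0_norm ?invr_gt0// ler_pdivrMl//.
have i1 := continuous_integrable_itv 0 (2 * pi) cv.
apply: (le_trans (le_normr_Rintegral _ i1)); first exact: measurable_itv.
(* The pointwise bound |v| <= v^2 / (2e) + e / 2 takes the place of Cauchy-Schwarz; its integral
   over the period is at most 2 pi e. *)
pose w x := (2 * e)^-1 * v x ^+ 2 + e / 2.
have cw1 : continuous (fun x => (2 * e)^-1 * v x ^+ 2).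
  by move=> x; apply: cvgM; [exact: cvg_cst|exact: cv2].
have cw : continuous w.
  by move=> x; apply: (@cvgD _ R^o); [exact: cw1|exact: cvg_cst].
have vw : \int[leb]_(x in `[0, 2 * pi]) `|v x| <= \int[leb]_(x in `[0, 2 * pi]) w x.
  apply: le_Rintegral; [exact: measurable_itv|exact: continuous_integrable_itv|exact: continuous_integrable_itv|].
  move=> x _; rewrite /w -subr_ge0.
  have -> : (2 * e)^-1 * v x ^+ 2 + e / 2 - `|v x| = (2 * e)^-1 * (`|v x| - e) ^+ 2.
    by rewrite -(real_normK (num_real (v x))); field; rewrite gt_eqF.
  by rewrite mulr_ge0 ?sqr_ge0// invr_ge0 mulr_ge0// ltW.
apply: (le_trans vw); rewrite /w RintegralD; last 3 first.
- exact: measurable_itv.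
- exact: continuous_integrable_itv.
- by apply: (@continuous_integrable_itv R (cst (e / 2))); exact: cst_continuous.
have -> : \int[leb]_(x in `[0, 2 * pi]) ((2 * e)^-1 * v x ^+ 2) =
    (2 * e)^-1 * \int[leb]_(x in `[0, 2 * pi]) (v x ^+ 2).
  apply: (@RintegralZl _ _ R leb _ (fun x => v x ^+ 2)); first exact: measurable_itv.
  exact: continuous_integrable_itv.
rewrite Rintegral_cst; last exact: measurable_itv.
rewrite [X in _ + _ * fine X]lebesgue_measure_itv/= lte_fin pp sube0/=.
move: v2; rewrite ler_pdivrMl//; set I := Rintegral _ _ _ => v2.
have {}v2 : (2 * e)^-1 * I <= pi * e.
  by rewrite ler_pdivrMl ?mulr_gt0// (le_trans v2)// le_eqVlt; apply/orP; left; apply/eqP; ring.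
by lra.
Qed.

Lemma measurable_normc2 (f : R -> R[i]) :
  measurable_fun setT (fun x => complex.Re (f x)) ->
  measurable_fun setT (fun x => complex.Im (f x)) ->
  measurable_fun setT (fun x => (normc (f x) ^+ 2)%:E).
Proof.
move=> mr mi; apply/measurable_EFinP.
rewrite (_ : (fun x => _) = fun x => complex.Re (f x) ^+ 2 + complex.Im (f x) ^+ 2).
  by apply: measurable_funD; exact: measurable_funX.
apply/funext => x; case: (f x) => a b /=.
by rewrite sqr_sqrtr// addr_ge0// sqr_ge0.
Qed.

Lemma cLnorm2_lt (h : R -> R[i]) (e : R) : 0 < e -> (cLnorm 2%:E h < e%:E)%E ->
  (\int[mu]_x (normc (h x) ^+ 2)%:E <= (e ^+ 2)%:E)%E.
Proof.
move=> e0 he.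
have -> : (\int[mu]_x (normc (h x) ^+ 2)%:E = cLnorm 2%:E h `^ 2)%E.
  rewrite /cLnorm poweR_Lnorm ?pnatr_eq0//; apply: eq_integral => x _.
  by rewrite abse_EFin poweR_EFin powR_mulrn// real_normK ?num_real.
have -> : ((e ^+ 2)%:E = e%:E `^ 2)%E by rewrite poweR_EFin powR_mulrn// ltW.
apply: gt0_ler_poweR => //; rewrite ?in_itv/= ?leey ?lee_fin ?(ltW e0) ?(ltW he)//.
by rewrite Lnorm_ge0.
Qed.

Lemma ReB (z w : R[i]) : complex.Re (z - w) = complex.Re z - complex.Re w.
Proof. by case: z w => [a b] [c d]. Qed.

Lemma normc_nonneg (z : R[i]) : 0 <= normc z.
Proof. by case: z => a b; exact: sqrtr_ge0. Qed.

Lemma Re_mul_le (u z : R[i]) : complex.Re (u * z) ^+ 2 <= normc u ^+ 2 * normc z ^+ 2.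
Proof.
case: u z => [a b] [c d] /=; rewrite !sqr_sqrtr ?addr_ge0 ?sqr_ge0//.
rewrite -subr_ge0 (_ : _ - _ = (a * d + b * c) ^+ 2) ?sqr_ge0//; ring.
Qed.

Lemma continuous_Re_mul (g : R -> R[i]) (u : R[i]) : ccontinuous g ->
  continuous (fun x => complex.Re (u * g x)).
Proof.
move=> [cr ci]; rewrite (_ : (fun x => _) = fun x =>
  complex.Re u * complex.Re (g x) - complex.Im u * complex.Im (g x)).
  move=> x; apply: (@cvgB _ R^o); apply: cvgM; [exact: cvg_cst|exact: cr|exact: cvg_cst|exact: ci].
by apply/funext => x; case: u (g x) => [a b] [c d].
Qed.

(** The approximating polynomial p has integral 0 against the cosine, so the integral for g equals
    that of the difference, which almost everywhere is at most |u| |f - p| and hence arbitrarily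
    small in L2. *)
Lemma calT_spectral_gap k (f g : R -> R[i]) (u : R[i]) : calT k f -> circle_fun g ->
  ccontinuous g -> {ae mu, forall x, f x = g x} ->
  spectral_gap k (fun x => complex.Re (u * g x)).
Proof.
move=> [[_ mfr mfi _] fT] pg cg fg j a jk.
pose v x := complex.Re (u * g x) * cos (j%:R * x + a).
have ccos : continuous (fun x : R => cos (j%:R * x + a) : R).
  move=> x; apply: (@continuous_comp _ _ _ (fun x : R => j%:R * x + a : R) (@cos R)); last exact: continuous_cos.
  by apply: cvgD; [apply: cvgM; [exact: cvg_cst|exact: cvg_id]|exact: cvg_cst].
have cv : continuous v.
  by move=> x; apply: cvgM; [exact: continuous_Re_mul|exact: ccos].
have pv (x : R) : v (x + 2 * pi) = v x.
  rewrite /v pg; congr (_ * _).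
  have -> : j%:R * (x + 2 * pi) + a = j%:R * x + a + (pi *+ 2) *+ j.
    by rewrite -[_ *+ j]mulr_natl -mulr_natl; ring.
  by rewrite periodicn//; exact: cosD2pi.
(* A zero integral over one period makes the primitive [int0 v] periodic. *)
suff v0 : \int[mu]_x v x = 0.
  exists (int0 v) => x; first exact: is_derive_int0.
  have dU1 y : is_derive y (1:R) (fun y => int0 v (y + 2 * pi)) (v y).
    by rewrite -pv; apply: is_derive_shift; exact: is_derive_int0.
  have := derive_eq_cst dU1 (is_derive_int0 cv) x 0; rewrite add0r int00 subr0.
  have -> : int0 v (2 * pi) = 0.
    apply: (mulfI (x := (2 * pi)^-1)); first by rewrite invr_eq0 mulf_neq0// gt_eqF// pi_gt0.
    move: v0; rewrite circle_Rintegral// (Rintegral_FTC2 cv (is_derive_int0 cv)) ?mulr_ge0 ?pi_ge0//.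
    by rewrite int00 subr0 mulr0.
  by move/eqP; rewrite subr_eq0 => /eqP.
have U1 : 0 < normc u + 1 by rewrite ltr_wpDl// normc_nonneg.
apply/eqP; rewrite -normr_le0; apply/ler_addgt0Pl => e0 e0p; rewrite addr0.
(* The summand 1 keeps the denominator positive when u = 0. *)
pose e := e0 / (normc u + 1); have ep : 0 < e by rewrite divr_gt0.
have [p pT fp] := fT e ep.
have [cp sp] := high_trig_Re u pT.
(* The multipliers 1 and -i extract the real and imaginary parts of p, whose continuity yields the
   measurability of f - p. *)
have [cpr _] := high_trig_Re 1 pT; have [cpi _] := high_trig_Re (- 'i) pT.
pose w x := complex.Re (u * p x) * cos (j%:R * x + a).
have cw : continuous w by move=> x; apply: cvgM; [exact: cp|exact: ccos].
have cvw : continuous (fun x => v x - w x).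
  by move=> x; apply: (@cvgB _ R^o); [exact: cv|exact: cw].
have vwE : \int[mu]_x v x = \int[mu]_x (v x - w x).
  rewrite [RHS]circle_Rintegral// RintegralB; last 3 first.
  - exact: measurable_itv.
  - exact: continuous_integrable_itv.
  - exact: continuous_integrable_itv.
  rewrite mulrBr -!circle_Rintegral// (circle_Rintegral_mean_zero cw) ?subr0//.
  exact: sp.
rewrite vwE; apply: circle_Rintegral_le_L2 => //.
have mfp : measurable_fun setT (fun x => (normc (f x - p x) ^+ 2)%:E).
  apply: measurable_normc2.
    rewrite (_ : (fun x => _) = fun x => complex.Re (f x) - complex.Re (1 * p x)).
      by apply: measurable_funB => //; exact: continuous_measurable_fun.
    by apply/funext => x; rewrite mul1r; case: (f x) (p x) => [? ?] [? ?].
  rewrite (_ : (fun x => _) = fun x => complex.Im (f x) - complex.Re (- 'i * p x)).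
    by apply: measurable_funB => //; exact: continuous_measurable_fun.
  by apply/funext => x; case: (f x) (p x) => [? ?] [? ?] /=; ring.
have := cLnorm2_lt ep fp.
have u2 : 0 <= normc u ^+ 2 by exact: sqr_ge0.
move=> /(@lee_wpmul2l R (normc u ^+ 2)%:E); rewrite lee_fin => /(_ u2).
rewrite -ge0_integralZl//; last by move=> x _; rewrite lee_fin sqr_ge0.
move=> fpe; apply: (@le_trans _ _ ((normc u ^+ 2)%:E * (e ^+ 2)%:E)%E); last first.
  rewrite -EFinM lee_fin -exprMn ler_sqr ?nnegrE ?mulr_ge0 ?(ltW ep) ?invr_ge0 ?(ltW U1) ?normc_nonneg ?(ltW e0p)//.
  rewrite /e mulrCA ler_piMr ?(ltW e0p)// ler_pdivrMr// mul1r; lra.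
apply: le_trans fpe; apply: ae_ge0_le_integral => //.
- by move=> x _; rewrite lee_fin sqr_ge0.
- apply/measurable_EFinP; apply: measurable_funX; exact: continuous_measurable_fun.
- by move=> x _; rewrite -EFinM lee_fin mulr_ge0// sqr_ge0.
- exact: measurable_funeM.
apply: negligibleS fg => x /= nle fgx; apply: nle => _; rewrite -EFinM lee_fin fgx.
have -> : v x - w x = complex.Re (u * (g x - p x)) * cos (j%:R * x + a).
  by rewrite /v /w -mulrBl mulrBr ReB.
rewrite exprMn; apply: le_trans (Re_mul_le _ _).
by rewrite ler_piMr ?sqr_ge0// -(cos2Dsin2 (j%:R * x + a)) lerDl sqr_ge0.
Qed.

End HighFrequency.

(** * The sharp Lipschitz constant from an almost everywhere bound *)

Section LipschitzAE.
Variable R : realType.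
Local Notation leb := (@lebesgue_measure R).
Implicit Types (G Phi : R -> R) (a b x y e L M : R).

(** Real induction: the supremum s of the points up to which the bound holds satisfies it too, and
    if s < b the local bound at s carries it further. *)
Lemma local_to_global G Phi a b : a <= b ->
  (forall x y, a <= x -> x <= y -> y <= b -> Phi x <= Phi y) ->
  (forall x, a <= x <= b -> exists2 d, 0 < d &
     forall y, a <= y <= b -> `|y - x| < d -> `|G y - G x| <= `|Phi y - Phi x|) ->
  `|G b - G a| <= Phi b - Phi a.
Proof.
move=> ab mPhi loc.
pose S := [set x | a <= x <= b /\ `|G x - G a| <= Phi x - Phi a].
have Sa : S a by split; rewrite ?lexx ?ab// !subrr normr0.
have ubS : ubound S b by move=> x [/andP[]].
have hS : has_sup S by split; [exists a|exists b].
pose s := sup S.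
have as_ : a <= s by exact: ub_le_sup hS.2 _ Sa.
have sb : s <= b by apply: ge_sup => //; exists a.
have sab : a <= s <= b by rewrite as_ sb.
have [d d0 sd] := loc s sab.
have [x Sx xs] := sup_adherent d0 hS.
have xles : x <= s by exact: ub_le_sup hS.2 _ Sx.
have [/andP[ax xb] Gx] := Sx.
have Ss : `|G s - G a| <= Phi s - Phi a.
  have h := sd x (introT andP (conj ax xb)); rewrite -/s in xs.
  have {}h : `|G x - G s| <= `|Phi x - Phi s|.
    by apply: h; rewrite ler0_norm ?subr_le0//; lra.
  rewrite [X in _ <= X]ler0_norm ?subr_le0 ?mPhi// in h.
  have := ler_normD (G s - G x) (G x - G a); rewrite addrA subrK (distrC (G s) (G x)); lra.
suff -> : b = s by [].
apply/le_anti; rewrite sb andbT leNgt; apply/negP => sltb.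
pose y := Num.min b (s + d / 2).
have sy : s < y by rewrite lt_min sltb ltrDl divr_gt0.
have yb : y <= b by rewrite ge_min lexx.
have yd : y <= s + d / 2 by rewrite ge_min lexx orbT.
have h : `|G y - G s| <= `|Phi y - Phi s|.
  by apply: sd; rewrite ?yb ?(le_trans as_ (ltW sy))// gtr0_norm ?subr_gt0//; lra.
rewrite [X in _ <= X]ger0_norm ?subr_ge0 ?mPhi ?(ltW sy)// in h.
suff : y <= s by rewrite leNgt sy.
apply: ub_le_sup hS.2 _ _; split; first by rewrite yb (le_trans as_ (ltW sy)).
by have := ler_normD (G y - G s) (G s - G a); rewrite addrA subrK; lra.
Qed.

(** The distribution function of U from a: at points of an open U it has slope 1, and its total rise
    is at most the measure of U. *)
Definition lebesgue_cdf a (U : set R) x : R := fine (leb (U `&` `]a, x])).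

Lemma lebesgue_cdf_sub a (U : set R) x y : measurable U -> a <= x -> x <= y ->
  lebesgue_cdf a U y - lebesgue_cdf a U x = fine (leb (U `&` `]x, y])).
Proof.
move=> mU ax xy.
have mI u v : measurable (U `&` `]u, v]) by apply: measurableI => //; exact: measurable_itv.
have fI u v : leb (U `&` `]u, v]) \is a fin_num.
  rewrite ge0_fin_numE ?measure_ge0//.
  apply: (@le_lt_trans _ _ (leb `]u, v])).
    by apply: le_measure; rewrite ?inE; [exact: mI|exact: measurable_itv|exact: subIsetr].
  by rewrite lebesgue_measure_itv/=; case: ifP => _; rewrite ?ltry// -EFinD ltry.
rewrite /lebesgue_cdf (_ : U `&` `]a, y] = (U `&` `]a, x]) `|` (U `&` `]x, y])); last first.
  rewrite -setIUr; congr (_ `&` _); apply/seteqP; split => t /=; rewrite !in_itv/=.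
    by move=> /andP[at_ ty]; have [tx|tx] := leP t x; [left|right]; rewrite ?at_ ?ty.
  by case=> /andP[t1 t2]; rewrite ?t1 ?t2 ?(le_trans t2) ?(le_lt_trans ax)//.
rewrite measureU; [|exact: mI|exact: mI|]; last first.
  apply/seteqP; split => t //= [[_ +] [_ +]]; rewrite !in_itv/= => /andP[_ tx] /andP[].
  by rewrite ltNge tx.
rewrite fineD; [|exact: fI|exact: fI].
by rewrite addrAC subrr add0r.
Qed.

Lemma lebesgue_cdf_open a (U : set R) x : open U -> U x -> a <= x -> exists2 d, 0 < d &
  forall y, a <= y -> `|y - x| < d -> lebesgue_cdf a U y - lebesgue_cdf a U x = y - x.
Proof.
move=> oU Ux ax; have mU := open_measurable oU.
have [d /= d0 dU] := oU x Ux; exists d => // y ay yx.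
have inU u v : `|u - x| < d -> `|v - x| < d -> u <= v -> fine (leb (U `&` `]u, v])) = v - u.
  move=> ux vx uv; rewrite setIidr.
    rewrite lebesgue_measure_itv/= lte_fin; case: ltP => // vu.
    by rewrite (le_anti (introT andP (conj uv vu))) subrr.
  move=> t /=; rewrite in_itv/= => /andP[ut tv]; apply: dU => /=.
  rewrite distrC; move: ux vx; rewrite !ltr_distl => /andP[u1 _] /andP[_ v2].
  by apply/andP; split; lra.
have xx : `|x - x| < d by rewrite subrr normr0.
have [xy|yx'] := leP x y; first by rewrite lebesgue_cdf_sub// inU.
apply: oppr_inj; rewrite !opprB lebesgue_cdf_sub//; last exact: ltW.
by rewrite inU// ltW.
Qed.

(** An open U of measure below e covers the bad set N. The increments of G are compared with those
    of Phi: at points of N the slope 1 of phi on U absorbs the rough constant L, at the other points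
    the term (M + e) x suffices, and the phi term contributes at most L e in total. *)
Lemma lipschitz_of_ae_derivative G L M a b (N : set R) : 0 <= M -> 0 <= L -> a <= b ->
  (forall x y, `|G x - G y| <= L * `|x - y|) -> measurable N -> leb N = 0%E ->
  (forall x, a <= x <= b -> ~ N x -> derivable G x 1 /\ `|derive1 G x| <= M) ->
  `|G b - G a| <= M * (b - a).
Proof.
move=> M0 L0 ab lipG mN N0 dG.
apply/ler_addgt0Pl => e0 e0p.
(* The total error is e (b - a) + e L; the summand 1 keeps the denominator positive. *)
pose e := e0 / (b - a + L + 1).
have den : 0 < b - a + L + 1 by lra.
have ep : 0 < e by rewrite divr_gt0.
have [U [oU NU UN]] : exists U : set R, [/\ open U , N `<=` U & (leb (U `\` N) < e%:E)%E].
  apply: lebesgue_regularity_outer => //.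
  by apply: (@le_lt_trans _ _ 0%E); [rewrite le_eqVlt; apply/orP; left; apply/eqP; exact: N0|exact: ltry].
have Ue : (leb U < e%:E)%E.
  have mU := open_measurable oU.
  have E := @measureDI _ _ _ leb U N mU mN; rewrite setIidr// in E.
  suff -> : leb U = leb (U `\` N) by exact: UN.
  by apply: (etrans E); rewrite -[RHS]adde0; congr (_ + _)%E; exact: N0.
pose phi := lebesgue_cdf a U.
have mphi x y : a <= x -> x <= y -> phi x <= phi y.
  by move=> ax xy; rewrite -subr_ge0 lebesgue_cdf_sub ?fine_ge0//; exact: open_measurable.
pose Phi x := (M + e) * x + L * phi x.
have H : `|G b - G a| <= Phi b - Phi a.
  apply: local_to_global => // [x y ax xy yb|x axb].
    by rewrite lerD// ler_wpM2l ?mphi// addr_ge0// ltW.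
  have same y : a <= y -> `|Phi y - Phi x| = (M + e) * `|y - x| + L * `|phi y - phi x|.
    move=> ay; have /andP[ax _] := axb.
    have -> : Phi y - Phi x = (M + e) * (y - x) + L * (phi y - phi x) by rewrite /Phi; ring.
    have Me : 0 <= M + e by rewrite addr_ge0// ltW.
    have [xy|yx] := leP x y.
      have yx0 : 0 <= y - x by rewrite subr_ge0.
      have ph0 : 0 <= phi y - phi x by rewrite subr_ge0 mphi.
      by rewrite (ger0_norm yx0) (ger0_norm ph0) ger0_norm// addr_ge0// mulr_ge0.
    have h := mphi _ _ ay (ltW yx).
    have yx0 : y - x <= 0 by rewrite subr_le0 ltW.
    have ph0 : phi y - phi x <= 0 by rewrite subr_le0.
    rewrite (ler0_norm yx0) (ler0_norm ph0) ler0_norm; first by ring.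
    by rewrite -oppr_ge0 opprD -!mulrN addr_ge0// mulr_ge0// oppr_ge0.
  have [Nx|nNx] := pselect (N x).
    have /andP[ax xb] := axb.
    have [d d0 dphi] := lebesgue_cdf_open oU (NU _ Nx) ax.
    exists d => // y /andP[ay _] yx; rewrite same// /phi dphi//.
    by rewrite (le_trans (lipG y x))// lerDr mulr_ge0 ?normr_ge0// addr_ge0// ltW.
  have [dGx Mx] := dG x axb nNx.
  have [d d0 dlin] : exists2 d, 0 < d & forall y, `|y - x| < d -> `|G y - G x| <= (M + e) * `|y - x|.
    have /is_derive1_caratheodory[g [gE cg gx]] : is_derive x 1 G (derive1 G x).
      by apply: DeriveDef => //; rewrite derive1E.
    have /cvgrPdist_lt/(_ e ep)[d /= d0 gd] := cg.
    exists d => // y yx; rewrite gE normrM ler_wpM2r//.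
    have := gd y; rewrite /= distrC => /(_ yx); rewrite gx => gye.
    have := ler_normD (derive1 G x) (- (derive1 G x - g y)).
    by rewrite normrN opprB addrC subrK; lra.
  exists d => // y /andP[ay _] yx; rewrite same//.
  by rewrite (le_trans (dlin y yx))// lerDl mulr_ge0.
apply: (le_trans H).
have phie : phi b - phi a <= e.
  rewrite lebesgue_cdf_sub//; last exact: open_measurable.
  rewrite -lee_fin fineK.
    apply: le_trans (ltW Ue); apply: le_measure; rewrite ?inE; last exact: subIsetl.
      by apply: measurableI; [exact: open_measurable|exact: measurable_itv].
    exact: open_measurable.
  rewrite ge0_fin_numE ?measure_ge0//; apply: le_lt_trans (lt_trans Ue (ltry _)).
  apply: le_measure; rewrite ?inE; last exact: subIsetl.
    by apply: measurableI; [exact: open_measurable|exact: measurable_itv].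
  exact: open_measurable.
have Lphi : L * (phi b - phi a) <= L * e by rewrite ler_wpM2l.
have ee : e * (b - a + L + 1) = e0 by rewrite /e mulfVK// gt_eqF.
by rewrite /Phi; nra.
Qed.

End LipschitzAE.

(** * Essential suprema, periodic extension and rotation *)

Section EssentialSup.
Variable R : realType.
Local Notation leb := (@lebesgue_measure R).
Local Notation mu := (@circle_measure R).

Lemma cLnorm_pinftyE (f : R -> R[i]) :
  cLnorm +oo f = ess_sup mu (fun x => (normc (f x))%:E).
Proof.
(* The norm at infinity is an essential supremum only on a space of positive measure, hence the
   appeal to total mass 1. *)
rewrite /cLnorm unlock ifT; last by rewrite [X in (0 < X)%E]circle_measureT.
congr ess_sup; apply/funext => x /=; congr (_%:E).
by rewrite ger0_norm ?normc_nonneg.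
Qed.

Lemma cLnorm_pinfty_le (f : R -> R[i]) (c : R) :
  {ae mu, forall x, normc (f x) <= c} -> (cLnorm +oo f <= c%:E)%E.
Proof.
move=> fc; rewrite cLnorm_pinftyE; apply/ess_supP.
by apply: negligibleS fc => x /= nle le; apply: nle; rewrite lee_fin.
Qed.

Lemma normc_ae_le_cLnorm (f : R -> R[i]) (c : R) : (cLnorm +oo f <= c%:E)%E ->
  {ae mu, forall x, normc (f x) <= c}.
Proof.
rewrite cLnorm_pinftyE => /ess_supP fc.
by apply: negligibleS fc => x /= nle le; apply: nle; rewrite -lee_fin.
Qed.

Lemma circle_reduce_itv (x : R) : exists (y : R) (n : int),
  x = y + n%:~R * (2 * pi) /\ 0 <= y < 2 * pi.
Proof.
have pi0 := pi_gt0 R.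
have [y [n [-> /andP[y1 y2]]]] := circle_reduce x.
have [y0|y0] := leP 0 y; first by exists y, n; split => //; apply/andP; split; lra.
exists (y + 2 * pi), (n - 1); split; last by apply/andP; split; lra.
by rewrite intrB; ring.
Qed.

Lemma norm_le_of_ae (P : R -> R) (c : R) : continuous P ->
  (forall x, P (x + 2 * pi) = P x) -> {ae mu, forall x, `|P x| <= c} ->
  forall x, `|P x| <= c.
Proof.
move=> cP pP aeP x; have pi0 := pi_gt0 R.
have [y [n [-> /andP[y0 y2]]]] := circle_reduce_itv x.
rewrite (periodic_int _ _ pP) leNgt; apply/negP => cPy.
have cn : continuous (fun x => `|P x|) by move=> z; apply: cvg_norm; exact: cP.
have /cvgrPdist_lt/(_ (`|P y| - c)) := cn y; rewrite subr_gt0 => /(_ cPy)[d /= d0 Pd].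
(* An interval to the right of y stays inside the half-open fundamental domain and has positive
   measure. *)
pose b := Num.min (y + d) (2 * pi).
have yb : y < b by rewrite lt_min y2 ltrDl d0.
have bd : b <= y + d by rewrite ge_min lexx.
have b2 : b <= 2 * pi by rewrite ge_min lexx orbT.
have [A [mA A0 nA]] := aeP.
have IA : `]y, b[ `<=` A `&` `[0, 2 * pi[.
  move=> z /=; rewrite in_itv/= => /andP[z1 z2]; split; last first.
    by rewrite in_itv/= (le_trans y0 (ltW z1)) (lt_le_trans z2).
  apply: nA => /= Pz.
  have yz : `|y - z| < d by rewrite ltr0_norm ?subr_lt0//; lra.
  have /= := Pd z yz.
  have := ler_norm (`|P y| - `|P z|); lra.
have mI : measurable (`[0, 2 * pi[ : set R) by exact: measurable_itv.
have I0 : (leb `]y, b[ <= 0)%E.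
  have <- := circle_null A0.
  apply: le_measure => //; rewrite inE; first exact: measurable_itv.
  by apply: measurableI => //; exact: measurable_itv.
by move: I0; rewrite lebesgue_measure_itv/= lte_fin yb -EFinD lee_fin subr_le0 leNgt yb.
Qed.

Lemma cLnorm_pinfty_real (P : R -> R) y0 : continuous P ->
  (forall x, P (x + 2 * pi) = P x) -> (forall x, `|P x| <= `|P y0|) ->
  cLnorm +oo (fun x => (P x)%:C) = `|P y0|%:E.
Proof.
move=> cP pP Py0.
have nE x : normc (P x)%:C = `|P x| by rewrite /= expr0n addr0 sqrtr_sqr.
have le : (cLnorm +oo (fun x => (P x)%:C) <= `|P y0|%:E)%E.
  by apply/cLnorm_pinfty_le/aeW => x; rewrite nE.
apply/le_anti; rewrite le/= leNgt; apply/negP => lt.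
have [c Lc cP0] : exists2 c : R, (cLnorm +oo (fun x => (P x)%:C) <= c%:E)%E & c < `|P y0|.
  case: (cLnorm _ _) lt => [r| |]//.
    by rewrite lte_fin => ?; exists r.
  by move=> _; exists (`|P y0| - 1); rewrite ?leNye// ltrBlDr ltrDl.
have := @norm_le_of_ae P c cP pP _ y0; rewrite leNgt cP0 => H.
suff : false by []; apply: H.
by apply: negligibleS (normc_ae_le_cLnorm Lc) => x nle nx; apply: nle; move: nx => /=; rewrite expr0n addr0 sqrtr_sqr.
Qed.

Lemma circle_EVT (h : R -> R) : continuous h -> (forall x, h (x + 2 * pi) = h x) ->
  exists x0, forall x, h x <= h x0.
Proof.
move=> ch ph; have pi0 := pi_gt0 R.
have pp : 0 <= 2 * pi :> R by rewrite mulr_ge0// ltW.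
have [x0 _ hx0] := EVT_max pp (continuous_itv ch).
exists x0 => x; have [y [n [-> /andP[y0 y2]]]] := circle_reduce_itv x.
by rewrite (periodic_int _ _ ph) hx0// in_itv/= y0 ltW.
Qed.

(** Splitting at 0 extends the bound to [-2 pi, 2 pi]. By periodicity any two points closer than pi
    can be moved there together, and [local_to_global] does the rest. *)
Lemma periodic_lipschitz (G : R -> R) M : 0 <= M -> (forall x, G (x + 2 * pi) = G x) ->
  (forall a b, 0 <= a -> a <= b -> b <= 2 * pi -> `|G b - G a| <= M * (b - a)) ->
  forall x y, `|G x - G y| <= M * `|x - y|.
Proof.
move=> M0 pG lip; have pi0 := pi_gt0 R.
have lip2 a b : - (2 * pi) <= a -> a <= b -> b <= 2 * pi -> `|G b - G a| <= M * (b - a).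
  move=> a2 ab b2.
  have [a0|a0] := leP 0 a; first exact: lip.
  have Ga : G a = G (a + 2 * pi) by rewrite pG.
  have [b0|b0] := leP 0 b; last first.
    rewrite Ga -(pG b); apply: le_trans (lip _ _ _ _ _) _; [lra|lra|lra|].
    by rewrite opprD addrACA subrr addr0.
  have h1 := lip 0 b (lexx _) b0 b2.
  have h2 : `|G 0 - G a| <= M * (0 - a).
    rewrite Ga -(pG 0); apply: le_trans (lip _ _ _ _ _) _; [lra|lra|lra|].
    by rewrite opprD addrACA subrr addr0.
  have := ler_normD (G b - G 0) (G 0 - G a); rewrite addrA subrK; lra.
have lip3 a b : - (2 * pi) <= a <= 2 * pi -> - (2 * pi) <= b <= 2 * pi ->
    `|G b - G a| <= M * `|b - a|.
  move=> /andP[a1 a2] /andP[b1 b2]; have [ab|ba] := leP a b.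
    by rewrite [X in M * X]ger0_norm ?subr_ge0// lip2.
  by rewrite distrC [X in M * X]distrC [X in M * X]gtr0_norm ?subr_gt0// lip2// ltW.
have mono a b : a <= b -> `|G b - G a| <= M * (b - a).
  move=> ab; rewrite mulrBr; apply: (local_to_global (Phi := fun t => M * t)) => //.
    by move=> x y _ xy _; rewrite ler_wpM2l.
  move=> x _; exists pi => // y _ yx; rewrite -mulrBr normrM ger0_norm//.
  have [x0 [n [E /andP[x1 x2]]]] := circle_reduce x.
  have -> : G x = G x0 by rewrite E (periodic_int _ _ pG).
  have -> : G y = G (x0 + (y - x)).
    by rewrite -[RHS](periodic_int _ n pG); congr (G _); rewrite E; ring.
  have -> : `|y - x| = `|x0 + (y - x) - x0| by congr (`| _ |); ring.
  move: yx; rewrite ltr_norml => /andP[? ?].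
  by apply: lip3; apply/andP; split; lra.
move=> x y; have [xy|yx] := leP x y; last by rewrite [X in M * X]gtr0_norm ?subr_gt0// mono// ltW.
by rewrite distrC [X in M * X]distrC [X in M * X]ger0_norm ?subr_ge0// mono.
Qed.

Lemma exists_rotation (z : R[i]) : exists2 u : R[i], normc u = 1 &
  complex.Re (u * z) = normc z.
Proof.
case: z => a b; have [r0|r0] := eqVneq (normc (a +i* b)) 0.
  by exists 1; rewrite ?normc1// mul1r (eq0_normc r0) normc0.
(* The multiplier is the conjugate of z divided by its modulus. *)
pose r := normc (a +i* b); exists ((a / r) +i* (- b / r)).
  have r2 : a ^+ 2 + b ^+ 2 = r ^+ 2 by rewrite /r /= sqr_sqrtr// addr_ge0 ?sqr_ge0.
  rewrite /= !exprMn sqrrN -mulrDl r2 exprVn mulfV ?sqrtr1//.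
  by rewrite expf_neq0.
have r2 : a ^+ 2 + b ^+ 2 = r ^+ 2 by rewrite /r /= sqr_sqrtr// addr_ge0 ?sqr_ge0.
rewrite -/r /=; apply: (mulfI r0); rewrite -/r.
transitivity (a ^+ 2 + b ^+ 2); last by rewrite r2 expr2.
by field; exact: r0.
Qed.

Lemma norm_Re_mul_le (u z : R[i]) : normc u = 1 -> `|complex.Re (u * z)| <= normc z.
Proof.
move=> u1; rewrite -ler_sqr ?nnegrE ?normc_nonneg ?normr_ge0// real_normK ?num_real//.
by apply: le_trans (Re_mul_le _ _) _; rewrite u1 expr1n mul1r.
Qed.

End EssentialSup.

(** * The extremal function and the inequality *)

Section BohrFavard.
Variable R : realType.
Local Notation leb := (@lebesgue_measure R).
Local Notation mu := (@circle_measure R).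

(** [P j] carries n - j primitives of c_k, so that j counts derivatives: [P 0] is the extremal
    function and [P n] the wave. For n = 0 the wave peaks at its corner 0. *)
Lemma comparison_function k n : (0 < k)%N -> exists (P : nat -> R -> R) y0,
  [/\ (forall j x, (j < n)%N -> is_derive x (1:R) (P j) (P j.+1 x)),
      continuous (P n) /\ spectral_gap k (P 0%N),
      forall x, P 0%N (x + 2 * pi) = P 0%N x,
      unit_slope_on_arcs k (P n) &
      [/\ forall y, `|P 0%N y| <= `|P 0%N y0|, n = 0%N -> y0 = 0 &
        cLnorm +oo (iter n (@mean0_primitive R) (triangle_k k)) = `|P 0%N y0|%:E]].
Proof.
move=> k0; pose P j := iter (n - j) (@rprimitive R) (rtriangle k).
have cP j : continuous (P j) by have [] := @iter_rprimitive_cont_antiperiodic R k (n - j) k0.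
have aP j (x : R) : P j (x + pi / k%:R) = - P j x.
  by have [_ h] := @iter_rprimitive_cont_antiperiodic R k (n - j) k0; exact: h.
have pP j (x : R) : P j (x + 2 * pi) = P j x by exact: antiperiodic_2pi k0 (aP j) x.
have Pn : P n = rtriangle k by rewrite /P subnn.
have [y0 [Py0 ny0]] : exists y0, (forall y, `|P 0%N y| <= `|P 0%N y0|) /\ (n = 0%N -> y0 = 0).
  have [n0|n0] := posnP n.
    by exists 0; split => // y; move: Pn; rewrite n0 => ->; exact: rtriangle_le.
  have [x|x|y0 hy0] := @circle_EVT R (fun x => `|P 0%N x|).
  - by apply: cvg_norm; exact: cP.
  - by rewrite pP.
  - by exists y0; split => // nn; rewrite nn in n0.
exists P, y0; split => //.
- move=> j x jn; rewrite {1}/P -(subnSK jn) iterS; apply: is_derive_rprimitive; exact: cP.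
- by split; [exact: cP|exact: spectral_gap_antiperiodic k0 (cP 0%N) (aP 0%N)].
- by rewrite Pn; exact: rtriangle_unit_slope.
- split => //; rewrite iter_mean0_primitive.
  by have := @cLnorm_pinfty_real R (P 0%N) y0 (cP _) (pP _) Py0; rewrite /P subn0.
Qed.

(** The circle measure does not see the endpoint 2 pi, which is therefore put into N. *)
Lemma null_set_of_ae (Q : R -> Prop) : {ae mu, forall x, Q x} ->
  exists N : set R, [/\ measurable N, leb N = 0%E &
    forall x, 0 <= x <= 2 * pi -> ~ N x -> Q x].
Proof.
move=> [A [mA A0 QA]]; have pi0 := pi_gt0 R.
have mI : measurable (`[0, 2 * pi[ : set R) by exact: measurable_itv.
have mAI : measurable (A `&` `[0, 2 * pi[) by exact: measurableI.
have AI0 := circle_null A0.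
exists ((A `&` `[0, 2 * pi[) `|` [set 2 * pi]); split.
- by apply: measurableU => //; exact: measurable_set1.
- have m1 : measurable [set (2 * pi : R)] by exact: measurable_set1.
  apply/(negligibleP leb (measurableU _ _ mAI m1)); apply: negligibleU.
    exact/(negligibleP leb mAI).
  by apply/(negligibleP leb m1); exact: lebesgue_measure_set1.
- move=> x /andP[x0 x2] nN; apply: contrapT => nQ; apply: nN.
  move: x2; rewrite le_eqVlt => /predU1P[->|x2]; first by right.
  by left; split; [exact: QA|rewrite /= in_itv/= x0].
Qed.

Lemma Wclass_bound k m (f g : R -> R[i]) (P : nat -> R -> R) y0 M : (0 < k)%N -> (0 < m)%N ->
  calT k f -> {ae mu, forall x, f x = g x} -> Wclass m g ->
  (cLnorm +oo (cderiven m g) <= M%:E)%E -> 0 <= M ->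
  (forall j x, (j < m.-1)%N -> is_derive x (1:R) (P j) (P j.+1 x)) ->
  continuous (P m.-1) -> spectral_gap k (P 0%N) ->
  (forall x, P 0%N (x + 2 * pi) = P 0%N x) -> unit_slope_on_arcs k (P m.-1) ->
  (forall y, `|P 0%N y| <= `|P 0%N y0|) -> (m.-1 = 0%N -> y0 = 0) ->
  0 < `|P 0%N y0| /\ forall x, normc (g x) <= M * `|P 0%N y0|.
Proof.
move=> k0 m0 Tf fg [[pg _ _ _] [dg cgn] [L lipg] [M' aeg]] gM M0 dP cP sP pP slP Py0 ny0.
set n := m.-1 in cgn lipg aeg dP cP slP ny0 *.
have mn : m = n.+1 by rewrite prednK.
(* The bound in [Wclass] is an arbitrary constant; it is replaced by M, read off the essential
   supremum. *)
rewrite mn in gM; have {}aeg : {ae mu, forall x, cderivable (cderiven n g) x /\ normc (cderiven n.+1 g x) <= M}.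
  have A1 : mu.-negligible (~` [set x | normc (cderiven n.+1 g x) <= M]) by exact: normc_ae_le_cLnorm gM.
  apply: negligibleS (negligibleU aeg A1) => x /= nQ.
  have [gx|ngx] := pselect (normc (cderiven n.+1 g x) <= M); last by right.
  by left => -[dgx _]; apply: nQ.
have g0 x : cderiven 0 g x = g x by rewrite /cderiven /=; case: (g x).
pose Gu (u : R[i]) j x := complex.Re (u * cderiven j g x).
have Rederive u j x : cderivable (cderiven j g) x -> is_derive x (1:R) (Gu u j) (Gu u j.+1 x).
  move=> [dr di].
  have GuE i : Gu u i = fun y => complex.Re u * derive1n i (fun t => complex.Re (g t)) y
       - complex.Im u * derive1n i (fun t => complex.Im (g t)) y.
    by apply/funext => y; rewrite /Gu /cderiven; case: u.
  have d1 : is_derive x (1:R) (derive1n j (fun t => complex.Re (g t)))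
     (derive1n j.+1 (fun t => complex.Re (g t)) x).
    by apply: DeriveDef => //; rewrite derive1nS derive1E.
  have d2 : is_derive x (1:R) (derive1n j (fun t => complex.Im (g t)))
     (derive1n j.+1 (fun t => complex.Im (g t)) x).
    by apply: DeriveDef => //; rewrite derive1nS derive1E.
  rewrite !GuE; exact: is_deriveB (is_deriveZ (complex.Re u) d1) (is_deriveZ (complex.Im u) d2).
have cg : ccontinuous g.
  have [n0|n0] := posnP n; first by move: cgn; rewrite n0.
  by split => x; apply: differentiable_continuous; apply/derivable1_diffP; have [] := dg 0%N x n0.
have pGu u j : (j <= n)%N -> forall x, Gu u j (x + 2 * pi) = Gu u j x.
  elim: j => [_ x|j IH jn]; first by rewrite /Gu !g0 pg.
  by apply: derive_periodic (IH (ltnW jn)) => x; apply: Rederive; exact: dg.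
have cn2 : continuous (fun x => normc (g x) ^+ 2).
  rewrite (_ : (fun x => _) = fun x => complex.Re (g x) ^+ 2 + complex.Im (g x) ^+ 2).
    have [cr ci] := cg.
    by move=> x; apply: (@cvgD _ R^o); apply: cvgM; [exact: cr|exact: cr|exact: ci|exact: ci].
  by apply/funext => x; case: (g x) => a b /=; rewrite sqr_sqrtr// addr_ge0 ?sqr_ge0.
have [x0 gx0] : exists x0, forall x, normc (g x) <= normc (g x0).
  have [x|x0 h] := circle_EVT cn2; first by rewrite pg.
  by exists x0 => x; rewrite -ler_sqr ?nnegrE ?normc_nonneg.
have [u u1 ugx0] := exists_rotation (g x0).
(* With u chosen at the peak x0 of |g|, [G 0] equals |g| at x0 and is bounded by |g| elsewhere, so
   its modulus peaks there too. *)
pose G := Gu u.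
have G0x0 : G 0%N x0 = normc (g x0) by rewrite /G /Gu g0.
have dG j x : (j < n)%N -> is_derive x (1:R) (G j) (G j.+1 x).
  by move=> jn; apply: Rederive; exact: dg.
have lipGL x y : `|G n x - G n y| <= L * `|x - y|.
  by rewrite /G /Gu -ReB -mulrBr (le_trans (norm_Re_mul_le _ u1)).
have L0 : 0 <= L.
  by have := le_trans (normr_ge0 _) (lipGL 0 1); rewrite sub0r normrN normr1 mulr1.
(* The constant L is only qualitative; together with the almost everywhere bound on one period it
   yields the sharp M. *)
have lipGM x y : `|G n x - G n y| <= M * `|x - y|.
  apply: periodic_lipschitz => //; first exact: pGu.
  have [N [mN N0 QN]] := null_set_of_ae aeg.
  move=> a b a0 ab b2; apply: (lipschitz_of_ae_derivative (L := L) (N := N)) => // t /andP[ta tb] Nt.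
  have [|dt Mt] := QN t _ Nt; first by rewrite (le_trans a0 ta) (le_trans tb b2).
  have [dGt Gt] := Rederive u n t dt.
  by split => //; rewrite derive1E Gt (le_trans (norm_Re_mul_le _ u1)).
have sG : spectral_gap k (G 0%N).
  have := calT_spectral_gap u Tf pg cg fg.
  by rewrite /G /Gu; under [X in _ -> spectral_gap _ X]eq_fun do rewrite g0.
have cG : continuous (G n).
  exact: (continuous_Re_mul (g := cderiven n g)).
have Gx0 x : `|G 0%N x| <= `|G 0%N x0|.
  rewrite G0x0 [X in _ <= X]ger0_norm ?normc_nonneg// /G /Gu g0.
  exact: (le_trans (norm_Re_mul_le (g x) u1) (gx0 x)).
have [K0 GK] := comparison k0 dG cG (pGu u 0%N (leq0n _)) sG lipGM dP cP pP sP slP Gx0 Py0 ny0.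
split => // x; apply: le_trans (gx0 x) _.
by move: GK; rewrite G0x0 ger0_norm ?normc_nonneg.
Qed.

End BohrFavard.

Theorem theorem1p1 (R : realType) (k m : nat) (hk : (0 < k)%N) (hm : (0 < m)%N)
    (f : R -> R[i]) (hf : calT k f) :
  (Ckm R k m * cLnorm +oo f <= deriv_norm m f)%E.
Proof.
have [P [y0 [dP [cP sP] pP slP [Py0 ny0 KE]]]] := comparison_function R m.-1 hk.
(* [deriv_norm] is an infimum over representatives, so each g is treated separately; without any,
   the infimum is infinite and nothing remains to prove. *)
rewrite /Ckm KE; apply: le_ereal_inf_tmp => _ [g [Wg fg] <-].
have : (0 <= cLnorm +oo (cderiven m g))%E by exact: Lnorm_ge0.
case E : (cLnorm +oo (cderiven m g)) => [M| |] // M0; last by rewrite leey.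
have gM : (cLnorm +oo (cderiven m g) <= M%:E)%E by rewrite E.
have [K0 gK] := Wclass_bound hk hm hf fg Wg gM M0 dP cP sP pP slP Py0 ny0.
(* The inverse in the extended reals is the real one because the peak of [P 0] is positive. *)
rewrite inver gt_eqF//.
have fK : (cLnorm +oo f <= (M * `|P 0%N y0|)%:E)%E.
  apply: cLnorm_pinfty_le; apply: negligibleS fg => x nle fgx; apply: nle.
  by rewrite /= fgx.
apply: le_trans (lee_wpmul2l _ fK) _; first by rewrite lee_fin invr_ge0 ltW.
by rewrite -EFinM lee_fin mulrC mulfK// gt_eqF.
Qed.
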